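(* Let $K$ be a product formula field with normalized system of absolute values $\{|\cdot|_v\}_{v\in M_K}$ satisfying the product formula, and let $X$ be a projective variety over $K$ with $\dim(X)\ge 1$. Let $\phi:X\to X$ be a polarized dynamical system on $X$ defined over $K$, and let $f:\mathbb{P}^N_K\to\mathbb{P}^N_K$ be a morphism that extends $\phi$ via an embedding $\iota:X\hookrightarrow\mathbb{P}^N_K$, i.e. $f\circ\iota=\iota\circ\phi$. Let $F:\mathbb{A}^{N+1}_K\to\mathbb{A}^{N+1}_K$ be any homogeneous lift of $f$, and for each $v\in M_K$ let $\mathcal{K}_v$ be the $v$-adic homogeneous filled Julia set of $F$. For each integer $n\ge 1$, let $\mathcal{B}_n$ be any basis of $H^0(X,\iota^*(\mathcal{O}(n)))$. Then there is a constant $C=C(f)$, depending only on $f$, such that for all integers $n\ge 2$, $$\sum_{v\in M_K}\log d_{\mathcal{B}_n}(\mathcal{K}_v\cap\pi_v^{-1}(X_v))\le\frac{C\log n}{n}.$$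
   Context: A product formula field is a field $K$ together with a nonempty set $\{|\cdot|_v\}_{v\in M_K}$ of pairwise inequivalent nontrivial absolute values on $K$ such that for each $\alpha\in K^*$ one has $|\alpha|_v=1$ for all but finitely many $v$, and $\prod_{v\in M_K}|\alpha|_v=1$. (Residue fields of completions are not required to be finite.) For $v\in M_K$, $\mathbb{C}_v$ denotes the completion of an algebraic closure of the completion $K_v$, with the extension of $|\cdot|_v$. A polarized dynamical system over $K$ is a triple $(X,\phi,\mathcal{L})$ with $X/K$ a projective variety, $\phi:X\to X$ an endomorphism, and $\mathcal{L}$ an ample line bundle on $X$ with $\phi^*(\mathcal{L})\cong\mathcal{L}^{d}$ for some integer $d\ge 2$. The extension $f:\mathbb{P}^N\to\mathbb{P}^N$ is a morphism defined over $K$ of the same degree $d$ (given by homogeneous polynomials of degree $d$), and $\iota:X\hookrightarrow\mathbb{P}^N$ is the embedding given by a basis of $H^0(X,\mathcal{L}^m)$ for a suitable integer $m\ge1$ (equivalently, one may regard the data as a morphism $f$ of $\mathbb{P}^N$ of degree $d\ge2$ and a subvariety $X\subseteq\mathbb{P}^N$ with $f(X)\subseteq X$). A homogeneous lift of $f$ is a map $F=(F_0,\dots,F_N):\mathbb{A}^{N+1}\to\mathbb{A}^{N+1}$ with each $F_i\in K[x_0,\dots,x_N]$ homogeneous of degree $d$ and $f=[F_0:\cdots:F_N]$. With $\|(a_0,\dots,a_N)\|_v=\max_i|a_i|_v$ and $F^k$ the $k$-th iterate of $F$, the $v$-adic homogeneous filled Julia set of $F$ is $$\mathcal{K}_v=\{P\in\mathbb{A}^{N+1}(\mathbb{C}_v):\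 \|F^k(P)\|_v\not\to\infty\text{ as }k\to\infty\}.$$ Write $X_v=X\times_K\mathbb{C}_v$ and $\pi_v:\mathbb{A}^{N+1}_{\mathbb{C}_v}\setminus\{(0,\dots,0)\}\to\mathbb{P}^N_{\mathbb{C}_v}$ for the natural projection; $X$ is identified with its image under $\iota$. Let $c(n)=\dim H^0(X,\iota^*(\mathcal{O}(n)))$. Elements of $H^0(X,\iota^*(\mathcal{O}(n)))$ are evaluated at points of $\pi_v^{-1}(X_v)$ as homogeneous functions of degree $n$. For a basis $\mathcal{B}_n=\{\eta_1,\dots,\eta_{c(n)}\}$, $$d_{\mathcal{B}_n}(\mathcal{K}_v\cap\pi_v^{-1}(X_v))=\exp\left(\max_{(\widetilde{P_1},\dots,\widetilde{P_{c(n)}})\in(\mathcal{K}_v\cap\pi_v^{-1}(X_v))^{c(n)}}\frac{1}{n\cdot c(n)}\log\left|\det\left(\eta_j(\widetilde{P_i})\right)_{1\le i,j\le c(n)}\right|_v\right).$$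
   Formalization: C may depend on X as well as on f (not on F, n or the bases): uniformity in X for fixed f fails, e.g. for the power map on P^3, n=2 and the invariant curves [s^a : s^(a-1)t : st^(a-1) : t^a], where the sum is at least log(2a+1)/4. *)

(* Defs.v *)
From HB Require Import structures.
From mathcomp Require Import all_boot all_order all_algebra.
From mathcomp Require Import all_classical all_reals all_analysis.
(* The notations of mpoly clash with those of mathcomp-analysis. *)
From mathcomp Require mpoly.
Import (canonicals, coercions) mpoly.

Set Implicit Arguments.
Unset Strict Implicit.
Unset Printing Implicit Defensive.

Import Order.TTheory GRing.Theory Num.Theory.
Import numFieldNormedType.Exports.

Local Open Scope classical_set_scope.
Local Open Scope ring_scope.

(** * Absolute values and product formula fields *)

(* The triangle inequality is required only in Artin's weak form, so that the
   normalized absolute value |z|^2 at a complex place is covered; c = 2 shows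
   that every a with a (x + y) <= a x + a y qualifies. *)
Record is_absval (R : realType) (K : fieldType) (a : K -> R) : Prop :=
  IsAbsval {
    absval_ge0 : forall x, 0 <= a x;
    absval_eq0 : forall x, a x = 0 <-> x = 0;
    absvalM : forall x y, a (x * y) = a x * a y;
    absval_add : exists c : R, forall x y, a (x + y) <= c * Num.max (a x) (a y)
  }.

Definition absval_nontrivial (R : realType) (K : fieldType) (a : K -> R) :=
  exists2 x, x != 0 & a x != 1.

Definition absval_equiv (R : realType) (K : fieldType) (a b : K -> R) :=
  exists2 s : R, 0 < s & forall x, b x = a x `^ s.

Record product_formula_field (R : realType) (K : fieldType) (M : choiceType)
    (av : M -> K -> R) : Prop := ProductFormulaField {
  pff_nonempty : [set: M] !=set0;
  pff_absval : forall v, is_absval (av v);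
  pff_nontrivial : forall v, absval_nontrivial (av v);
  pff_inequiv : forall v w, v <> w -> ~ absval_equiv (av v) (av w);
  pff_finite : forall x : K, x != 0 -> finite_set [set v | av v x != 1];
  pff_product : forall x : K, x != 0 ->
    \big[*%R/1]_(v \in [set: M]) av v x = 1
}.

(** * The field C_v *)

Definition absval_complete (R : realType) (L : fieldType) (b : L -> R) :=
  forall u : nat -> L,
    (forall e : R, 0 < e -> exists k0, forall k l,
       (k0 <= k)%N -> (k0 <= l)%N -> b (u k - u l) < e) ->
    exists x, forall e : R, 0 < e -> exists k0, forall k,
       (k0 <= k)%N -> b (u k - x) < e.

Definition is_completion (R : realType) (K L : fieldType)
    (a : K -> R) (b : L -> R) (i : {rmorphism K -> L}) :=
  [/\ is_absval b,
      forall x, b (i x) = a x,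
      forall (y : L) (e : R), 0 < e -> exists x, b (y - i x) < e
    & absval_complete b].

Definition is_algebraic_closure (K L : fieldType) (i : {rmorphism K -> L}) :=
  GRing.closed_field_axiom L /\ forall y, algebraicOver i y.

(* A completion of an algebraic closure of a completion of (K, a); it is unique
   up to isometric isomorphism over K. *)
Record complex_field (R : realType) (K : fieldType) (a : K -> R) :=
  ComplexField {
    cf_compl : fieldType;
    cf_compl_abs : cf_compl -> R;
    cf_to_compl : {rmorphism K -> cf_compl};
    cf_complP : is_completion a cf_compl_abs cf_to_compl;
    cf_alg : fieldType;
    cf_alg_abs : cf_alg -> R;
    cf_to_alg : {rmorphism cf_compl -> cf_alg};
    cf_algP : is_algebraic_closure cf_to_alg;
    cf_alg_absval : is_absval cf_alg_abs;
    cf_alg_ext : forall x, cf_alg_abs (cf_to_alg x) = cf_compl_abs x;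
    cf_sort :> fieldType;
    cf_abs : cf_sort -> R;
    cf_to_sort : {rmorphism cf_alg -> cf_sort};
    cf_sortP : is_completion cf_alg_abs cf_abs cf_to_sort
  }.

Definition cf_embed (R : realType) (K : fieldType) (a : K -> R)
    (Cv : complex_field a) : {rmorphism K -> Cv} :=
  (cf_to_sort Cv \o (cf_to_alg Cv \o cf_to_compl Cv))%FUN.

(** * Projective varieties and morphisms of projective space *)

Notation poly_ring K N := (mpoly.mpoly N.+1 K).

Definition xvar (K : fieldType) (N : nat) (i : 'I_N.+1) : poly_ring K N :=
  mpoly.mpolyX K (mpoly.mnm1 i).

Definition homogeneous (K : fieldType) (N d : nat) (p : poly_ring K N) : bool :=
  p \is @mpoly.ishomog1 N.+1 K d mpoly.mdeg.

(* Points of affine space with coordinates in an extension i : K -> L. *)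
Definition peval (K L : fieldType) (N : nat) (i : {rmorphism K -> L})
    (P : 'I_N.+1 -> L) (p : poly_ring K N) : L := mpoly.mmap i P p.

Definition eval_map (K L : fieldType) (N : nat) (i : {rmorphism K -> L})
    (F : 'I_N.+1 -> poly_ring K N) (P : 'I_N.+1 -> L) : 'I_N.+1 -> L :=
  fun j => peval i P (F j).

Definition nonzero_pt (L : fieldType) (N : nat) (P : 'I_N.+1 -> L) :=
  exists j, P j != 0.

Definition same_proj_pt (L : fieldType) (N : nat) (P Q : 'I_N.+1 -> L) :=
  exists2 c : L, c != 0 & forall j, P j = c * Q j.

(* The homogeneous prime ideals not containing all the variables, that is the
   points of the scheme P^N_K; I is the ideal of the integral closed subscheme
   X = Proj (K[x_0, ..., x_N] / I). *)
Record projective_variety (K : fieldType) (N : nat) (I : {pred poly_ring K N})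
    : Prop := ProjectiveVariety {
  pv_ideal : idealr_closed I;
  pv_prime : prime_idealr_closed I;
  pv_homogeneous : forall p d, p \in I ->
    @mpoly.pihomog N.+1 K mpoly.mdeg d p \in I;
  pv_nonempty : exists i, xvar K i \notin I
}.

(* There is a chain X >= Z_0 > Z_1 > ... > Z_r of integral closed
   subschemes. *)
Definition dim_ge (K : fieldType) (N : nat) (I : {pred poly_ring K N})
    (r : nat) :=
  exists J : nat -> {pred poly_ring K N},
    [/\ forall k, (k <= r)%N -> projective_variety (J k),
        {subset I <= J 0%N}
      & forall k, (k < r)%N ->
          {subset J k <= J k.+1} /\ ~ {subset J k.+1 <= J k}].

(* The points of pi^{-1}(X) over L. *)
Definition cone (K L : fieldType) (N : nat) (i : {rmorphism K -> L})
    (I : {pred poly_ring K N}) : set ('I_N.+1 -> L) :=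
  [set P | nonzero_pt P /\ forall p, p \in I -> peval i P p = 0].

(* [f_0 : ... : f_N] is a morphism P^N_K -> P^N_K given by forms of degree d:
   the f_j have no common zero in any field extension. *)
Definition is_morphism (K : fieldType) (N d : nat)
    (f : 'I_N.+1 -> poly_ring K N) :=
  (forall j, homogeneous d (f j)) /\
  forall (L : fieldType) (i : {rmorphism K -> L}) (P : 'I_N.+1 -> L),
    nonzero_pt P -> nonzero_pt (eval_map i f P).

Definition is_lift (K : fieldType) (N d : nat)
    (f F : 'I_N.+1 -> poly_ring K N) :=
  (forall j, homogeneous d (F j)) /\
  forall (L : fieldType) (i : {rmorphism K -> L}) (P : 'I_N.+1 -> L),
    nonzero_pt P -> same_proj_pt (eval_map i F P) (eval_map i f P).

Definition maps_into_itself (K : fieldType) (N : nat)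
    (f : 'I_N.+1 -> poly_ring K N) (I : {pred poly_ring K N}) :=
  forall (L : fieldType) (i : {rmorphism K -> L}) (P : 'I_N.+1 -> L),
    cone i I P -> cone i I (eval_map i f P).

(** * Global sections of O_X(n) *)

(* With S = K[x_0, ..., x_N] / I, the sheaf O_X(n) has sections (S_{x_i})_n on
   the chart x_i != 0.  A cochain stands for the family of fractions
   sec_num i / x_i^sec_exp; a common exponent for all charts is no restriction. *)
Record cochain (K : fieldType) (N : nat) := Cochain {
  sec_exp : nat;
  sec_num : 'I_N.+1 -> poly_ring K N
}.

(* The fractions have degree n and agree in S_{x_i x_j}. *)
Definition is_section (K : fieldType) (N : nat) (I : {pred poly_ring K N})
    (n : nat) (s : cochain K N) :=
  (forall i, homogeneous (n + sec_exp s) (sec_num s i)) /\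
  forall i j, exists m : nat,
    (xvar K i * xvar K j) ^+ m *
      (xvar K j ^+ sec_exp s * sec_num s i - xvar K i ^+ sec_exp s * sec_num s j) \in I.

(* Equality in every S_{x_i}. *)
Definition section_eq (K : fieldType) (N : nat) (I : {pred poly_ring K N})
    (s t : cochain K N) :=
  forall i, exists m : nat,
    xvar K i ^+ m *
      (xvar K i ^+ sec_exp t * sec_num s i - xvar K i ^+ sec_exp s * sec_num t i) \in I.

Definition section0 (K : fieldType) (N : nat) : cochain K N :=
  Cochain 0 (fun=> 0).

(* \sum_j a_j eta_j, brought to the common denominator
   x_i^(\sum_j sec_exp (eta_j)) on the i-th chart. *)
Definition section_lincomb (K : fieldType) (N c : nat) (a : 'I_c -> K)
    (eta : 'I_c -> cochain K N) : cochain K N :=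
  Cochain (\sum_(j < c) sec_exp (eta j))%N
    (fun i => \sum_(j < c)
       a j *: (xvar K i ^+ (\sum_(l < c | l != j) sec_exp (eta l))%N
               * sec_num (eta j) i)).

Definition is_basis (K : fieldType) (N : nat) (I : {pred poly_ring K N})
    (n c : nat) (eta : 'I_c -> cochain K N) :=
  [/\ forall j, is_section I n (eta j),
      forall a : 'I_c -> K,
        section_eq I (section_lincomb a eta) (section0 K N) ->
        forall j, a j = 0
    & forall s, is_section I n s ->
        exists a : 'I_c -> K, section_eq I s (section_lincomb a eta)].

(* For s a section and P in the cone of X, the value does not depend on the
   chart that pick chooses. *)
Definition section_eval (K L : fieldType) (N : nat) (i : {rmorphism K -> L})
    (s : cochain K N) (P : 'I_N.+1 -> L) : L :=
  if [pick j | P j != 0] is Some j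
  then peval i P (sec_num s j) / P j ^+ sec_exp s else 0.

(** * Filled Julia sets and sectional capacities *)

Definition sup_norm (R : realType) (L : fieldType) (b : L -> R) (N : nat)
    (P : 'I_N.+1 -> L) : R := \big[Num.max/0]_(j < N.+1) b (P j).

Definition filled_julia (R : realType) (K : fieldType) (a : K -> R)
    (Cv : complex_field a) (N : nat) (F : 'I_N.+1 -> poly_ring K N)
    : set ('I_N.+1 -> Cv) :=
  [set P | ~ (sup_norm (@cf_abs _ _ _ Cv)
                (iter k (eval_map (cf_embed Cv) F) P) @[k --> \oo] --> +oo)].

Arguments filled_julia {R K a} Cv {N} F.

(* The maximum is read as a supremum, log 0 being -oo. *)
Definition sectional_d (R : realType) (K : fieldType) (a : K -> R)
    (Cv : complex_field a) (N n c : nat) (eta : 'I_c -> cochain K N)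
    (E : set ('I_N.+1 -> Cv)) : \bar R :=
  expeR (ereal_sup
    [set ((n * c)%:R^-1)%:E *
         lne (cf_abs (\det (\matrix_(i < c, j < c)
                section_eval (cf_embed Cv) (eta j) (P i))))%:E
    | P in [set P : 'I_c -> 'I_N.+1 -> Cv | forall i, E (P i)]])%E.

(* Unordered sum of a family of extended reals.  The dual addition gives
   +oo - oo = +oo, so an upper bound below +oo says in particular that the
   positive parts are summable. *)
Definition place_sum (R : realType) (M : choiceType) (h : M -> \bar R)
    : \bar R :=
  dual_adde (\esum_(v in [set: M]) (h^\+)%E v)
            (- \esum_(v in [set: M]) (h^\-)%E v)%E.

(* Main.v *)
Require Import Defs.
From HB Require Import structures.
From mathcomp Require Import all_boot all_order all_algebra.
From mathcomp Require Import all_classical all_reals all_analysis.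
From mathcomp Require mpoly.
From mathcomp Require Import ring_quotient fraction perm.
From mathcomp Require Import ring lra zify.
Import (canonicals, coercions) mpoly.
Import -(notations) mpoly.

Set Implicit Arguments.
Unset Strict Implicit.
Unset Printing Implicit Defensive.

Import Order.TTheory GRing.Theory Num.Theory.
Import numFieldNormedType.Exports.

Local Open Scope classical_set_scope.
Local Open Scope ring_scope.

(** The sum over the places does not depend on the basis of sections: two bases
  differ by an invertible matrix over K, the determinants that define the
  capacities are multiplied by its determinant, and the product formula makes
  the contribution of a nonzero element of K to the sum vanish
  ([basis_change], [product_formula_log]). The theorem therefore follows once
  the sections of degree n are spanned by finitely many sections that are small
  on all the filled Julia sets at once: the determinant of a c x c matrix is a
  sum of c! products of c entries, which costs only c log c at the places where
  the triangle inequality is not the ultrametric one ([place_sum_estimate]).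
  These places are among those with |2| > 1, hence finite in number
  ([absval_ultrametric], [place_const_weak]).

  The small sections come from the dynamics. The Nullstellensatz writes a power
  of each variable as a combination of the forms f_j, so that K[x] is generated
  over K[f_0, ..., f_N] by the monomials g of degree less than some t
  ([pullback_generation]). Iterating, the forms of degree n are spanned by the
  products g_0 * (g_1 o f) * (g_2 o f o f) * ..., with about log n factors g_i of
  degree less than t ([gens_span]). The same identities give
  ||P||^d <= B ||f(P)|| with B = 1 at almost all places ([place_growth]), so a
  point of the filled Julia set of f, together with its whole forward orbit, has
  norm at most B. Each of those products is thus bounded by B^(t k) with
  k = O(log n) ([gens_bound]); after division by n and summation over the
  finitely many places with B > 1, this is the bound C log n / n.

  A lift of f is F = kappa f with kappa in K^* ([lift_scalar]). Replacing f by F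
  scales the filled Julia set at v by the real radius
  |kappa|_v^(-1/(d-1)); this changes the sum by a multiple of
  sum_v log |kappa|_v = 0, and the constant does not depend on F.

  Two points relate the sections of O(n) on X to forms. For n at least some j0
  every section is a form: a section with denominator a^e, where a is a variable
  that does not vanish on X, has a numerator in the saturation of I + (a), and an
  ideal of K[x] contains all forms of large degree in its saturation
  ([saturation_stable], by Dickson's lemma), so that a can be divided out
  ([large_degree_sections]). For each of the finitely many n < j0, one fixed basis
  plays the role of the spanning set for all the other bases: its values are
  bounded by H ||P||^n ([place_section_bound]). *)

(** * The generic point of a prime ideal *)

Section QuotientDomain.
Variables (A : comNzRingType) (I : prime_idealr A).

Definition prime_quot : Type := {ideal_quot I}.
HB.instance Definition _ := GRing.ComNzRing.on prime_quot.

(** The inverse is chosen classically: all that is wanted is the integral domain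
  structure that the fraction field construction takes as input. *)
Definition prime_quot_unit : pred prime_quot := fun x => `[< exists y, y * x = 1 >].
Definition prime_quot_inv (x : prime_quot) : prime_quot :=
  if pselect (exists y, y * x = 1) is left h then sval (cid h) else x.

Fact prime_quot_mulVr : {in prime_quot_unit, left_inverse 1 prime_quot_inv *%R}.
Proof.
move=> x /asboolP hx; rewrite /prime_quot_inv.
by case: pselect => // h; case: (cid h).
Qed.

Fact prime_quot_unitP (x y : prime_quot) : y * x = 1 -> prime_quot_unit x.
Proof. by move=> h; apply/asboolP; exists y. Qed.

Fact prime_quot_invr_out : {in [predC prime_quot_unit], prime_quot_inv =1 id}.
Proof.
move=> x; rewrite inE /= => /asboolPn hx; rewrite /prime_quot_inv.
by case: pselect => // h; case: hx.
Qed.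

HB.instance Definition _ := GRing.ComNzRing_hasMulInverse.Build prime_quot
  prime_quot_mulVr prime_quot_unitP prime_quot_invr_out.
HB.instance Definition _ := GRing.ComUnitRing_isIntegral.Build prime_quot
  (@Quotient.rquot_IdomainAxiom A I).

Lemma prime_quot_projection : exists pi : {rmorphism A -> prime_quot},
  forall x, (pi x == 0) = (x \in I).
Proof.
pose g : {rmorphism A -> {ideal_quot I}} := (\pi_({ideal_quot I}))%qT.
exists g => x; rewrite -[x in RHS]subr0 Quotient.idealrBE -/g.
by rewrite -[(\pi_({ideal_quot I}) 0)%qT]/(g 0) rmorph0.
Qed.
End QuotientDomain.

Section PolyEval.
Variables (K : fieldType) (N : nat).
Implicit Types (p q : poly_ring K N).

Lemma peval_rmorphE (S : comNzRingType) (g : {rmorphism poly_ring K N -> S})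
    (i : {rmorphism K -> S}) (P : 'I_N.+1 -> S) :
  (forall c, i c = g (mpolyC N.+1 c)) -> (forall j, P j = g (xvar K j)) ->
  forall p, mmap i P p = g p.
Proof.
move=> hi hP p; rewrite [in RHS](mpolyE p) rmorph_sum /mmap.
apply: eq_bigr => m _; rewrite -mul_mpolyC rmorphM /= hi; congr (_ * _).
rewrite mpolyXE_id rmorph_prod /mmap1; apply: eq_bigr => j _.
by rewrite rmorphXn hP.
Qed.

Section Eval.
Variables (L : fieldType) (i : {rmorphism K -> L}) (P : 'I_N.+1 -> L).
Lemma pevalB p q : peval i P (p - q) = peval i P p - peval i P q.
Proof. exact: rmorphB. Qed.
Lemma pevalM p q : peval i P (p * q) = peval i P p * peval i P q.
Proof. exact: rmorphM. Qed.
Lemma pevalXn p n : peval i P (p ^+ n) = peval i P p ^+ n.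
Proof. exact: rmorphXn. Qed.
Lemma peval1 : peval i P 1 = 1.
Proof. exact: rmorph1. Qed.
Lemma pevalZ c p : peval i P (c *: p) = i c * peval i P p.
Proof. exact: mmapZ. Qed.
Lemma peval_sum (T : Type) (r : seq T) (Q : pred T) (F : T -> poly_ring K N) :
  peval i P (\sum_(t <- r | Q t) F t) = \sum_(t <- r | Q t) peval i P (F t).
Proof. exact: rmorph_sum. Qed.
Lemma peval_xvar j : peval i P (xvar K j) = P j.
Proof. by rewrite /peval /xvar mmapX mmap1U. Qed.
End Eval.

(** The class of (x_0, ..., x_N) in the fraction field of K[x] / I. It turns
  hypotheses about all points over all field extensions into ideal membership. *)
Lemma generic_point (I : {pred poly_ring K N}) :
  idealr_closed I -> prime_idealr_closed I ->
  exists (L : fieldType) (i : {rmorphism K -> L}) (P : 'I_N.+1 -> L),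
    forall p, (peval i P p == 0) = (p \in I).
Proof.
move=> Iideal Iprime.
pose mI := isIdealr.Build _ I Iideal.
pose mP := isPrimeIdealrClosed.Build _ I Iprime.
pose PI : prime_idealr (poly_ring K N) := HB.pack I mI mP.
have [pi piE] := prime_quot_projection PI.
exists {fraction prime_quot PI}.
pose i : {rmorphism K -> {fraction prime_quot PI}} :=
  (@tofrac (prime_quot PI) \o (pi \o @mpolyC N.+1 K))%FUN.
exists i, (fun j => tofrac (pi (xvar K j))) => p.
by rewrite /peval (@peval_rmorphE _ (@tofrac (prime_quot PI) \o pi)%FUN) //= tofrac_eq0 piE.
Qed.
End PolyEval.

(** * Nullstellensatz and lifts of a morphism *)

Section PrimeAvoidance.
Variable A : comNzRingType.
Implicit Types (J X : set A) (a x y : A).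

Definition is_ideal J := J 0 /\ forall a x y, J x -> J y -> J (a * x + y).

Lemma ideal0 J : is_ideal J -> J 0. Proof. by case. Qed.
Lemma idealD J x y : is_ideal J -> J x -> J y -> J (x + y).
Proof. by move=> [_ h] Jx Jy; rewrite -[x]mul1r; apply: h. Qed.
Lemma idealMl J x y : is_ideal J -> J x -> J (y * x).
Proof. by move=> [J0 h] Jx; rewrite -[_ * _]addr0; apply: h. Qed.
Lemma idealMr_comm J x y : is_ideal J -> J x -> J (x * y).
Proof. by rewrite mulrC; apply: idealMl. Qed.
Lemma idealB J x y : is_ideal J -> J x -> J y -> J (x - y).
Proof. by move=> hJ Jx Jy; apply: idealD => //; rewrite -mulN1r; apply: idealMl. Qed.

Definition adjoin J a : set A := [set x | exists u y, J y /\ x = u * a + y].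

Lemma is_ideal_adjoin J a : is_ideal J -> is_ideal (adjoin J a).
Proof.
move=> hJ; split; first by exists 0, 0; rewrite mul0r addr0; split=> //; exact: ideal0.
move=> b _ _ [u [x [Jx ->]]] [v [y [Jy ->]]]; exists (b * u + v), (b * x + y).
split; last by ring.
by case: hJ => _; apply.
Qed.

Lemma sub_adjoin J a : J `<=` adjoin J a.
Proof. by move=> x Jx; exists 0, x; rewrite mul0r add0r. Qed.

Lemma adjoin_mem J a : is_ideal J -> adjoin J a a.
Proof. by move=> hJ; exists 1, 0; rewrite mul1r addr0; split=> //; exact: ideal0. Qed.

(** An ideal maximal among those that contain J and no power of a is prime: if
  neither x nor y belongs to it, adjoining either one produces a power of a, and
  the product of the two powers would be produced by x * y. *)
Lemma prime_avoiding_powers J a : is_ideal J -> (forall n, ~ J (a ^+ n)) ->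
  exists I : {pred A}, [/\ idealr_closed I, prime_idealr_closed I,
    forall x, J x -> x \in I & a \notin I].
Proof.
move=> hJ Ja.
(* The empty set is admitted because the union of the empty chain is empty. *)
pose P X := X = set0 \/ [/\ is_ideal X, J `<=` X & forall n, ~ X (a ^+ n)].
have [F FP Ftot|M [PM Mmax]] := @Zorn_bigcup A P.
  have [F0|/existsNP[Y /not_implyP[FY Y0]]] := pselect (forall X, F X -> X = set0).
    left; rewrite -subset0 => x [X FX]; by rewrite (F0 _ FX).
  have good X : F X -> X !=set0 -> [/\ is_ideal X, J `<=` X & forall n, ~ X (a ^+ n)].
    by move=> FX /set0P/eqP X0; case: (FP _ FX).
  have nY : Y !=set0 by apply/set0P/eqP.
  have [Yid JY Ya] := good _ FY nY.
  right; split.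
  - split; first by exists Y => //; exact: ideal0.
    move=> b x y [X FX Xx] [Z FZ Zy].
    have [Xid _ _] := good _ FX (ex_intro _ x Xx).
    have [Zid _ _] := good _ FZ (ex_intro _ y Zy).
    have [XZ|ZX] := Ftot _ _ FX FZ.
      by exists Z => //; case: Zid => _; apply=> //; exact: XZ.
    by exists X => //; case: Xid => _; apply=> //; exact: ZX.
  - by move=> x Jx; exists Y => //; exact: JY.
  - by move=> n [X FX Xn]; have [_ _ /(_ n)] := good _ FX (ex_intro _ _ Xn).
have PJ : P J by right; split.
have [Mid JM Ma] : [/\ is_ideal M, J `<=` M & forall n, ~ M (a ^+ n)].
  case: PM => // M0; exfalso; apply: (Mmax J) => //; rewrite M0; split=> //.
  by move=> /(_ 0 (ideal0 hJ)).
have powers x : ~ M x -> exists n, adjoin M x (a ^+ n).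
  move=> Mx; apply: contrapT => /forallNP h.
  apply: (Mmax (adjoin M x)).
    split; first exact: sub_adjoin.
    by move=> /(_ x (adjoin_mem x Mid)).
  right; split=> //; first exact: is_ideal_adjoin.
  by apply: subset_trans JM _; exact: sub_adjoin.
exists (fun x => `[< M x >]); split.
- split; first by apply/asboolP; exact: ideal0.
    by apply/negP => /asboolP M1; apply: (Ma 0%N); rewrite expr0.
  by move=> b x y /asboolP Mx /asboolP My; apply/asboolP; case: Mid => _; apply.
- move=> x y /asboolP Mxy; apply/orP; apply: contrapT => /not_orP[].
  move=> /negP/asboolPn/powers[m [u [w [Mw um]]]] /negP/asboolPn/powers[n [v [z [Mz vn]]]].
  apply: (Ma (m + n)%N); rewrite exprD um vn.
  rewrite (_ : _ * _ = u * v * (x * y) + ((u * x) * z + w * (v * y + z))); last by ring.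
  by apply: idealD => //; [apply: idealMl|apply: idealD => //; [apply: idealMl|apply: idealMr_comm]].
- by move=> x /JM Mx; apply/asboolP.
- by apply/negP => /asboolP; apply: (Ma 1%N).
Qed.
End PrimeAvoidance.

Section Homogeneous.
Variables (K : fieldType) (N : nat).
Implicit Types (p q : poly_ring K N).
Local Notation hpart := (@pihomog N.+1 K mdeg).

Lemma homogeneousM d e p q :
  homogeneous d p -> homogeneous e q -> homogeneous (d + e) (p * q).
Proof. exact: dhomogM. Qed.
Lemma homogeneousX d n p : homogeneous d p -> homogeneous (d * n) (p ^+ n).
Proof. exact: dhomogMn. Qed.
Lemma homogeneousB d p q : homogeneous d p -> homogeneous d q -> homogeneous d (p - q).
Proof. by move=> hp hq; apply: rpredB. Qed.
Lemma homogeneousZ d (c : K) p : homogeneous d p -> homogeneous d (c *: p).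
Proof. by move=> hp; apply: rpredZ. Qed.
Lemma homogeneous_sum d (T : Type) (r : seq T) (P : pred T) (F : T -> poly_ring K N) :
  (forall t, P t -> homogeneous d (F t)) -> homogeneous d (\sum_(t <- r | P t) F t).
Proof. by move=> h; apply: rpred_sum. Qed.
Lemma homogeneous_xvar i : homogeneous 1 (xvar K i : poly_ring K N).
Proof. by rewrite /homogeneous dhomogX; apply/eqP; exact: mdeg1. Qed.
Lemma homogeneous_xvarX i n : homogeneous n (xvar K i ^+ n : poly_ring K N).
Proof. by rewrite -[X in homogeneous X]mul1n; apply/homogeneousX/homogeneous_xvar. Qed.
Lemma homogeneous_mpolyX m : homogeneous (mdeg m) (mpolyX K m : poly_ring K N).
Proof. by rewrite /homogeneous dhomogX. Qed.
Lemma homogeneous_hpart d p : homogeneous d (hpart d p).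
Proof. exact: pihomogP. Qed.
Lemma hpart_id d p : homogeneous d p -> hpart d p = p.
Proof. exact: pihomog_dE. Qed.
Lemma homogeneous_suppE d p m : homogeneous d p -> m \in msupp p -> mdeg m = d.
Proof. by move=> /dhomogP h /h. Qed.

Lemma hpartM d e p q : homogeneous d q -> hpart (e + d) (p * q) = hpart e p * q.
Proof.
move=> hq; rewrite {1}(@pihomog_partitionE _ _ mdeg (maxn (mmeasure mdeg p) e.+1) p) ?leq_maxl//.
rewrite mulr_suml linear_sum /=.
have he : (e < maxn (mmeasure mdeg p) e.+1)%N by rewrite leq_maxr.
rewrite (bigD1 (Ordinal he)) //= big1 ?addr0 => [|k ke].
  by apply: pihomog_dE; apply: homogeneousM => //; exact: pihomogP.
apply: (@pihomog_ne0 _ _ mdeg (k + d)%N); last first.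
  by apply: homogeneousM => //; exact: pihomogP.
by rewrite eqn_add2r; apply: contra ke => /eqP ke; apply/eqP/val_inj.
Qed.
End Homogeneous.

Section Nullstellensatz.
Variables (K : fieldType) (N d : nat) (f : 'I_N.+1 -> poly_ring K N).
Hypothesis f_morphism : is_morphism d f.

(** Otherwise a prime ideal contains all the forms f_j but not x_i, and its
  generic point is a common zero of the f_j. *)
Lemma xvar_radical i : exists n (h : 'I_N.+1 -> poly_ring K N),
  xvar K i ^+ n = \sum_j h j * f j.
Proof.
apply: contrapT => /forallNP noh.
pose J : set (poly_ring K N) := [set p | exists h, p = \sum_j h j * f j].
have Jid : is_ideal J.
  split; first by exists (fun=> 0); rewrite big1 // => j _; rewrite mul0r.
  move=> a _ _ [h ->] [g ->]; exists (fun j => a * h j + g j).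
  rewrite mulr_sumr -big_split; apply: eq_bigr => j _ /=; ring.
have [I [Iid Iprime JI xI]] := prime_avoiding_powers Jid noh.
have [L [e [P PE]]] := generic_point Iid Iprime.
have [] := f_morphism.2 L e P; first by exists i; rewrite -(peval_xvar e) PE.
move=> j; rewrite /eval_map PE JI //; exists (fun k => (k == j)%:R).
by rewrite (bigD1 j) //= eqxx mul1r big1 ?addr0 // => k /negPf ->; rewrite mul0r.
Qed.

(** A common exponent for all the variables, and homogeneous coefficients obtained
  by taking the parts of degree m - d. *)
Lemma xvar_nullstellensatz : exists (m : nat) (h : 'I_N.+1 -> 'I_N.+1 -> poly_ring K N),
  [/\ (d <= m)%N, forall i j, homogeneous (m - d) (h i j) &
      forall i, xvar K i ^+ m = \sum_j h i j * f j].
Proof.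
have /choice[n /choice[h hE]] := xvar_radical.
pose m := (d + \sum_i n i)%N.
have dm : (d <= m)%N by rewrite leq_addr.
exists m, (fun i j => pihomog mdeg (m - d) (xvar K i ^+ (m - n i) * h i j)).
split=> // [i j|i]; first exact: homogeneous_hpart.
rewrite -[LHS](hpart_id (homogeneous_xvarX K i m)).
have nm : (n i <= m)%N by rewrite (leq_trans _ (leq_addl _ _)) // (bigD1 i) //= leq_addr.
rewrite -{2}(subnK nm) exprD hE mulr_sumr linear_sum; apply: eq_bigr => j _ /=.
by rewrite mulrA -{1}(subnK dm) hpartM //; exact: f_morphism.1.
Qed.

(** Being a lift only says that F and f are proportional at every point. At the
  generic point of P^N the ratio is a rational function c; by the identities
  x_k^m = sum_j h_kj f_j, the product c x_k^m is a form g_k for every k. Since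
  g_0 x_l^m = g_l x_0^m, the form g_0 is a constant multiple of x_0^m. *)
Lemma lift_scalar F : is_lift d f F ->
  exists2 c : K, c != 0 & forall j, F j = c *: f j.
Proof.
move=> [Fhom Flift].
have [m [h [dm hhom hE]]] := xvar_nullstellensatz.
pose i : {rmorphism K -> {fraction poly_ring K N}} :=
  (@tofrac (poly_ring K N) \o @mpolyC N.+1 K)%FUN.
pose P j : {fraction poly_ring K N} := tofrac (xvar K j).
have PE p : peval i P p = tofrac p by rewrite /peval (@peval_rmorphE _ _ _ (@tofrac (poly_ring K N))).
have xvar_neq0 j : xvar K j != 0 :> poly_ring K N.
  by apply/eqP => /(congr1 (mcoeff (mnm1 j))); rewrite mcoeffX eqxx mcoeff0; apply/eqP/oner_neq0.
have [|c c0 cE] := Flift _ i P; first by exists ord0; rewrite /P tofrac_eq0.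
pose g k := \sum_j h k j * F j.
have ghom k : homogeneous m (g k).
  apply: homogeneous_sum => j _; rewrite -(subnK dm); exact: homogeneousM.
have gE k : tofrac (g k) = c * tofrac (xvar K k ^+ m).
  rewrite hE !rmorph_sum mulr_sumr; apply: eq_bigr => j _ /=.
  by rewrite !rmorphM /= -!PE [peval i P (F j)]cE mulrCA.
have gg k l : g k * xvar K l ^+ m = g l * xvar K k ^+ m.
  by apply/eqP; rewrite -tofrac_eq !rmorphM /= !gE; apply/eqP; ring.
have xvarXE (l : 'I_N.+1) : xvar K l ^+ m = mpolyX K (mnm_muln (mnm1 l) m).
  by rewrite /xvar mpolyXn.
(* A monomial of g_0 other than x_0^m involves some x_l with l != 0; comparing
   coefficients in g_0 x_l^m = g_l x_0^m shows that x_0^m divides it, which its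
   degree m excludes. *)
have g0E : g ord0 = mcoeff (mnm_muln (mnm1 ord0) m) (g ord0) *: xvar K ord0 ^+ m.
  apply/mpolyP => mu; rewrite mcoeffZ xvarXE mcoeffX.
  case: eqP => [<-|/eqP ne]; first by rewrite mulr1.
  rewrite mulr0; apply: memN_msupp_eq0; apply/negP => mu_supp.
  have mu_deg := homogeneous_suppE (ghom ord0) mu_supp.
  have [l l0 mul] : exists2 l : 'I_N.+1, l != ord0 & mu l != 0%N.
    apply: contrapT => /forall2NP nol; move/eqP: ne; apply; apply/mnmP => l.
    have others k : k != ord0 -> mu k = 0%N.
      by move=> k0; have [//|muk] := eqVneq (mu k) 0%N; case: (nol k).
    rewrite mulmnE mnm1E; case: eqP => [<-|/eqP]; last by rewrite eq_sym => /others ->.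
    rewrite mul1n -mu_deg mdegE (bigD1 ord0) //= big1 ?addn0 // => k /others //.
  have /(congr1 (mcoeff (mnm_add (mnm_muln (mnm1 l) m) mu))) := gg ord0 l.
  rewrite !xvarXE mcoeffMX => E.
  move: mu_supp; rewrite mcoeff_msupp E => /negP; apply.
  rewrite mcoeff_eq0; apply/negP; rewrite (perm_mem (msuppMX _ _)) => /mapP[nu _].
  move=> /(congr1 (fun u : multinom _ => u ord0)); rewrite !mnmDE !mulmnE !mnm1E eqxx.
  rewrite (negPf l0) mul0n add0n mul1n => mu0.
  move: mu_deg; rewrite mdegE (bigD1 ord0) //= (bigD1 l) //= mu0.
  by move/eqP; rewrite -addnA -{2}[m]addn0 eqn_add2l !addn_eq0 (negPf mul) andbF.
set a := mcoeff _ _ in g0E.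
have xm0 : xvar K ord0 ^+ m != 0 :> poly_ring K N by rewrite expf_neq0.
have ca : c = i a.
  apply: (mulIf (x := tofrac (xvar K ord0 ^+ m))); first by rewrite tofrac_eq0.
  by rewrite -gE g0E -mul_mpolyC rmorphM.
exists a; first by apply: contra_neq c0 => a0; rewrite ca a0 rmorph0.
move=> j; apply/eqP; rewrite -tofrac_eq -!PE [X in X == _]cE pevalZ ca; exact/eqP.
Qed.
End Nullstellensatz.

(** * Saturation of ideals in large degree *)

Section Dickson.
Variables (T : eqType) (c : nat -> T -> nat).

(** Dickson's lemma for the first k of the coordinates c_i. Let s0 be finite and
  suffice for the first k coordinates; it also suffices for those x whose
  coordinate k is at least the maximum b over s0. Below b, that coordinate takes
  finitely many values, and each slice has its own finite set. *)
Lemma dickson k (E : set T) : exists s : seq T,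
  (forall x, x \in s -> E x) /\
  forall x, E x -> exists2 y, y \in s & forall i, (i < k)%N -> (c i y <= c i x)%N.
Proof.
elim: k E => [|k IHk] E.
  have [[x Ex]|E0] := pselect (E !=set0).
    by exists [:: x]; split=> [y|y _]; [rewrite inE => /eqP ->|exists x; rewrite ?inE].
  by exists [::]; split=> // x Ex; case: E0; exists x.
have [s0 [s0E s0P]] := IHk E.
have /choice[s sP] v := IHk [set x | E x /\ c k x = v].
pose b := (\max_(y <- s0) c k y)%N.
exists (s0 ++ flatten [seq s v | v <- iota 0 b]); split=> [x|x Ex].
  rewrite mem_cat => /orP[/s0E//|/flattenP[t /mapP[v _ ->] xs]].
  by have [/(_ x xs)[]] := sP v.
have [ge_b|lt_b] := leqP b (c k x).
  have [y ys0 yx] := s0P x Ex; exists y; first by rewrite mem_cat ys0.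
  move=> i; rewrite ltnS leq_eqVlt => /orP[/eqP ->|/yx//].
  by apply: leq_trans ge_b; rewrite /b (big_rem y) //= leq_maxl.
have [_ /(_ x)[//|y ys yx]] := sP (c k x).
exists y.
  rewrite mem_cat; apply/orP; right; apply/flattenP; exists (s (c k x)) => //.
  by apply/mapP; exists (c k x); rewrite // mem_iota.
move=> i; rewrite ltnS leq_eqVlt => /orP[/eqP ->|/yx//].
by have [/(_ y ys)[_ ->]] := sP (c k x).
Qed.
End Dickson.

Section Saturation.
Variables (K : fieldType) (N : nat).
Implicit Types (p y : poly_ring K N) (Q : set (poly_ring K N)).

Lemma large_exponent (u : multinom N.+1) M :
  (N.+1 * M <= mdeg u)%N -> exists j, (M <= u j)%N.
Proof.
move=> h; apply: contrapT => /forallNP small; move: h; apply/negP; rewrite -ltnNge.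
have : (\sum_(j < N.+1) (u j).+1 <= \sum_(j < N.+1) M)%N.
  by apply: leq_sum => j _; rewrite ltnNge; apply/negP/small.
rewrite sum_nat_const card_ord mulnC; apply: leq_trans.
rewrite (eq_bigr (fun j => u j + 1)%N) => [|j _]; last by rewrite addn1.
by rewrite big_split -mdegE sum1_card card_ord /= -addSnnS leq_addr.
Qed.

Lemma mpolyX_split (u : multinom N.+1) M j : (M <= u j)%N ->
  exists2 w, mdeg u = (mdeg w + M)%N & mpolyX K u = mpolyX K w * xvar K j ^+ M.
Proof.
move=> Mu; have le_u : lem (mnm_muln (mnm1 j) M) u.
  apply/mnm_lepP => i; rewrite mulmnE mnm1E; case: eqP => [<-|_]; rewrite ?mul1n //.
exists (mnm_sub u (mnm_muln (mnm1 j) M)); last by rewrite /xvar mpolyXn -mpolyXD submK.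
by rewrite -{1}(submK le_u) mdegD mdegMn mdeg1 mul1n.
Qed.

Definition saturation Q := [set y | forall j, exists m, Q (xvar K j ^+ m * y)].

Lemma saturation_uniform Q y : is_ideal Q -> saturation Q y ->
  exists m0, forall m j, (m0 <= m)%N -> Q (xvar K j ^+ m * y).
Proof.
move=> Qid /choice[m mP]; exists (\sum_j m j)%N => k j jk.
have mk : (m j <= k)%N by rewrite (leq_trans _ jk) // (bigD1 j) //= leq_addr.
by rewrite -(subnK mk) exprD -mulrA; apply: idealMl.
Qed.

(** By Dickson's lemma there are finitely many forms p of the saturation such that
  the leading monomial of any form y of the saturation is divisible by that of some
  p. Subtracting a multiple of x^u p lowers the leading monomial of y. When the degree of y is
  large, x^u contains a high power of some x_j, so that x^u p lies in Q. *)
Lemma saturation_stable Q : is_ideal Q ->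
  exists j0, forall D y, (j0 <= D)%N -> homogeneous D y -> saturation Q y -> Q y.
Proof.
move=> Qid.
pose c i (p : poly_ring K N) := nth 0%N (mlead p) i.
have [s [sE sP]] := dickson c N.+1
  [set p | [/\ saturation Q p, p != 0 & exists e, homogeneous e p]].
have /choice[m0 m0P] : forall p, exists m0, p \in s ->
    forall m j, (m0 <= m)%N -> Q (xvar K j ^+ m * p).
  move=> p; have [ps|] := boolP (p \in s); last by exists 0%N.
  by have [/(saturation_uniform Qid)[m hm] _ _] := sE p ps; exists m.
pose M := (\sum_(p <- s) m0 p)%N.
exists (N.+1 * M + \sum_(p <- s) mdeg (mlead p))%N => D y leD.
have [n] : exists n, mlead y = n by exists (mlead y).
elim/(well_founded_ind (@ltom_wf N.+1)) : n y => n IH y ny yD yQ.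
have [->|y0] := eqVneq y 0; first exact: ideal0.
have [|p ps lead_le] := sP y; first by split=> //; exists D.
have [pQ p0 [e pe]] := sE p ps.
have ple : lem (mlead p) (mlead y).
  by apply/mnm_lepP => i; have := lead_le i (ltn_ord i); rewrite /c -!mnm_nth.
pose u := mnm_sub (mlead y) (mlead p).
have uE : mnm_add u (mlead p) = mlead y by rewrite /u submK.
have ydeg : mdeg (mlead y) = D by apply: homogeneous_suppE yD _; exact: mlead_supp.
have pdeg : mdeg (mlead p) = e by apply: homogeneous_suppE pe _; exact: mlead_supp.
have udeg : (mdeg u + e)%N = D by rewrite -ydeg -uE mdegD pdeg.
have uM : (N.+1 * M <= mdeg u)%N.
  rewrite -(leq_add2r e) udeg (leq_trans _ leD) // leq_add2l.
  by rewrite (big_rem p) //= pdeg leq_addr.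
have [j ju] := large_exponent uM.
have [w _ uw] := mpolyX_split ju.
have Qup : Q (mpolyX K u * p).
  rewrite uw -mulrA; apply: idealMl => //; apply: m0P => //.
  by rewrite /M (big_rem p) //= leq_addr.
pose a := mleadc y / mleadc p.
have a0 : a != 0 by rewrite mulf_neq0 ?invr_neq0 // mleadc_eq0.
pose t := a *: (mpolyX K u * p).
have Qt : Q t by rewrite /t -mul_mpolyC; apply: idealMl.
have tD : homogeneous D t.
  by apply: homogeneousZ; rewrite -udeg; apply: homogeneousM => //; exact: homogeneous_mpolyX.
have X0 : mpolyX K u != 0.
  by apply/eqP => /(congr1 (mcoeff u)); rewrite mcoeffX eqxx mcoeff0; apply/eqP/oner_neq0.
have tlead : mlead t = mlead y by rewrite /t mleadZ // mleadM // mleadXm.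
have tc : mleadc t = mleadc y.
  rewrite /t mleadcZE mleadM // mleadcM mleadXm mcoeffX eqxx mul1r /a divfK //.
  by rewrite mleadc_eq0.
suff Qyt : Q (y - t) by rewrite -(subrK t y); apply: idealD.
have [->|z0] := eqVneq (y - t) 0; first exact: ideal0.
apply: (IH (mlead (y - t))) => //; last first.
- move=> k; have [m mQ] := yQ k; exists m; rewrite mulrBr; apply: idealB => //.
  exact: idealMl.
- exact: homogeneousB.
rewrite lt_neqAle -ny; apply/andP; split; last first.
  by have := mleadB_le y t; rewrite tlead joinxx.
apply/eqP => zy; have := mlead_supp z0.
by rewrite zy mcoeff_msupp mcoeffB -{2}tlead tc subrr eqxx.
Qed.
End Saturation.

(** * Sections of O(n) as functions on the cone *)

Section Sections.
Variables (K : fieldType) (N : nat) (I : {pred poly_ring K N}).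
Hypothesis I_variety : projective_variety I.
Implicit Types (p y : poly_ring K N) (s t : cochain K N).

Lemma variety_ideal : is_ideal [set p | p \in I].
Proof. by have [I0 _ h] := pv_ideal I_variety; split=> // a x y; exact: h. Qed.

Lemma variety_prime x y : x * y \in I -> x \notin I -> y \in I.
Proof. by move=> /(pv_prime I_variety)/orP[->|]. Qed.

Lemma variety_primeX x y n : x ^+ n * y \in I -> x \notin I -> y \in I.
Proof.
move=> h xI; elim: n h => [|n IHn]; first by rewrite mul1r.
by rewrite exprS -mulrA => /variety_prime/(_ xI)/IHn.
Qed.

Definition poly_section p : cochain K N := Cochain 0 (fun=> p).

Lemma is_section_poly n p : homogeneous n p -> is_section I n (poly_section p).
Proof.
move=> pn; split=> [i|i j]; first by rewrite addn0.
by exists 0%N; rewrite !expr0 subrr mulr0; exact: (ideal0 variety_ideal).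
Qed.

Lemma section_charts n s i j : is_section I n s -> xvar K i \notin I -> xvar K j \notin I ->
  xvar K j ^+ sec_exp s * sec_num s i - xvar K i ^+ sec_exp s * sec_num s j \in I.
Proof.
move=> [_ /(_ i j)[m h]] iI jI; apply: (variety_primeX h).
by apply/negP => /variety_prime/(_ iI); apply/negP.
Qed.

(** If y / a^(e+1) is a section of degree n, then y lies in the saturation of
  I + (a) and has degree at least n; for n large, y = v a + r with r in I and
  y / a^(e+1) = v / a^e. Hence the denominator can be removed. *)
Lemma large_degree_sections : exists j0, forall n s, (j0 <= n)%N -> is_section I n s ->
  exists2 p, homogeneous n p & section_eq I s (poly_section p).
Proof.
have Iid := variety_ideal; have [i0 i0I] := pv_nonempty I_variety.
pose a : poly_ring K N := xvar K i0.
have [j0 j0P] := saturation_stable (is_ideal_adjoin a Iid).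
exists j0 => n s j0n sn.
(* [j0P] applies at each step because the degree n + e never drops below n. *)
have divide e y : homogeneous (n + e) y ->
    saturation (adjoin [set p | p \in I] (a ^+ e)) y ->
    exists2 p, homogeneous n p & y - p * a ^+ e \in I.
  elim: e y => [|e IHe] y yn ysat.
    exists y; first by rewrite -[n]addn0.
    by rewrite mulr1 subrr; exact: (ideal0 Iid).
  have [|||u [q [qI yE]]] := j0P (n + e.+1)%N y.
  - exact: leq_trans j0n (leq_addr _ _).
  - by [].
  - move=> j; have [m [u [q [qI E]]]] := ysat j; exists m, (u * a ^+ e), q.
    by split=> //; rewrite E exprSr mulrA.
  pose v := pihomog mdeg (n + e) u; pose r := pihomog mdeg (n + e.+1) q.
  have rI : r \in I by exact: (pv_homogeneous I_variety).
  have {}yE : y = v * a + r.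
    rewrite -[LHS](hpart_id yn) yE linearD /=; congr (_ + _).
    by rewrite addnS -[(n + e).+1]addn1 hpartM //; exact: homogeneous_xvar.
  have [|j|p pn pE] := IHe v.
  - exact: homogeneous_hpart.
  - have [m [w [q' [q'I E]]]] := ysat j.
    exists m, w, (xvar K j ^+ m * v - w * a ^+ e); split; last by rewrite addrC subrK.
    apply: (@variety_prime a) => //.
    rewrite (_ : a * _ = q' - xvar K j ^+ m * r).
      by apply: (idealB Iid) => //; apply: (idealMl _ Iid).
    by rewrite -(addKr (w * a ^+ e.+1) q') -E yE exprS; ring.
  - exists p => //; rewrite (_ : _ - _ = a * (v - p * a ^+ e) + r).
      by apply: (idealD Iid) => //; apply: (idealMl _ Iid).
    by rewrite yE exprS; ring.
have [||p pn pE] := divide (sec_exp s) (sec_num s i0).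
- exact: sn.1.
- move=> j; have [jI|jI] := boolP (xvar K j \in I).
    exists 1%N, 0, (xvar K j * sec_num s i0); rewrite mul0r add0r; split=> //.
    exact: (idealMr_comm _ Iid).
  exists (sec_exp s), (sec_num s j).
  exists (xvar K j ^+ sec_exp s * sec_num s i0 - a ^+ sec_exp s * sec_num s j).
  by split; [exact: section_charts sn _ _|ring].
exists p => // i; have [iI|iI] := boolP (xvar K i \in I).
  by exists 1%N; apply: (idealMr_comm _ Iid).
exists 0%N; rewrite !expr0 !mul1r /=.
apply: (@variety_primeX a _ (sec_exp s)) => //.
have := section_charts sn iI i0I; rewrite -/a => E.
rewrite (_ : a ^+ _ * _ = (a ^+ sec_exp s * sec_num s i - xvar K i ^+ sec_exp s * sec_num s i0)
  + xvar K i ^+ sec_exp s * (sec_num s i0 - p * a ^+ sec_exp s)); last by ring.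
by apply: (idealD Iid) => //; apply: (idealMl _ Iid).
Qed.

Section Evaluation.
Variables (L : fieldType) (i : {rmorphism K -> L}) (P : 'I_N.+1 -> L).

Lemma section_eval_chart n s k : cone i I P -> is_section I n s -> P k != 0 ->
  section_eval i s P = peval i P (sec_num s k) / P k ^+ sec_exp s.
Proof.
move=> [_ PI] sn Pk; rewrite /section_eval; case: pickP => [j Pj|/(_ k)]; last by rewrite Pk.
have xI l : P l != 0 -> xvar K l \notin I.
  by apply: contra => /PI; rewrite peval_xvar => ->.
have := PI _ (section_charts sn (xI _ Pj) (xI _ Pk)).
rewrite pevalB !pevalM !pevalXn !peval_xvar => /eqP; rewrite subr_eq0 => /eqP E.
by apply/eqP; rewrite eqr_div ?expf_neq0 // mulrC E mulrC.
Qed.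

Lemma section_eval_eq s t : cone i I P -> section_eq I s t ->
  section_eval i s P = section_eval i t P.
Proof.
move=> [_ PI] st; rewrite /section_eval; case: pickP => [j Pj|//].
have [m /PI] := st j; rewrite pevalM pevalB !pevalM !pevalXn !peval_xvar => /eqP.
rewrite mulf_eq0 (negPf (expf_neq0 _ Pj)) /= subr_eq0 => /eqP E.
by apply/eqP; rewrite eqr_div ?expf_neq0 // mulrC E mulrC.
Qed.

Lemma chart_eval_lincomb c (a : 'I_c -> K) (eta : 'I_c -> cochain K N) k : P k != 0 ->
  peval i P (sec_num (section_lincomb a eta) k) / P k ^+ sec_exp (section_lincomb a eta) =
  \sum_j i (a j) * (peval i P (sec_num (eta j) k) / P k ^+ sec_exp (eta j)).
Proof.
move=> Pk; rewrite /= peval_sum mulr_suml; apply: eq_bigr => j _.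
have -> : (\sum_(l < c) sec_exp (eta l) = sec_exp (eta j) + \sum_(l < c | l != j) sec_exp (eta l))%N.
  by rewrite (bigD1 j).
rewrite pevalZ pevalM pevalXn peval_xvar exprD.
by field; rewrite !expf_neq0.
Qed.

Lemma section_eval_lincomb c (a : 'I_c -> K) (eta : 'I_c -> cochain K N) :
  section_eval i (section_lincomb a eta) P = \sum_j i (a j) * section_eval i (eta j) P.
Proof.
rewrite /section_eval; case: pickP => [j Pj|_]; first exact: chart_eval_lincomb.
by rewrite big1 // => j _; rewrite mulr0.
Qed.

Lemma section_eval_poly p : nonzero_pt P -> section_eval i (poly_section p) P = peval i P p.
Proof.
move=> [k Pk]; rewrite /section_eval; case: pickP => [j Pj|/(_ k)]; last by rewrite Pk.
by rewrite expr0 divr1.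
Qed.
End Evaluation.

(** A linear relation between the values at the generic point of X is a relation
  between the sections. This makes it possible to do linear algebra with values
  in a field instead of cochains up to equality. *)
Lemma basis_free n c (eta : 'I_c -> cochain K N) (L : fieldType) (i : {rmorphism K -> L})
    (P : 'I_N.+1 -> L) :
  is_basis I n eta -> (forall p, (peval i P p == 0) = (p \in I)) -> cone i I P ->
  forall a : 'I_c -> K, \sum_j i (a j) * section_eval i (eta j) P = 0 -> forall j, a j = 0.
Proof.
move=> [etan free _] PE Pcone a a0; apply: free => k.
have [kI|kI] := boolP (xvar K k \in I).
  by exists 1%N; apply: (idealMr_comm _ variety_ideal).
have Pk : P k != 0 by rewrite -(peval_xvar i) PE.
exists 0%N; rewrite [sec_exp (section0 _ _)]/= !expr0 !mul1r mulr0 subr0 -PE.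
have : peval i P (sec_num (section_lincomb a eta) k) / P k ^+ sec_exp (section_lincomb a eta) = 0.
  rewrite chart_eval_lincomb // -[RHS]a0; apply: eq_bigr => j _.
  by rewrite (section_eval_chart Pcone (etan j) Pk).
by move/eqP; rewrite mulf_eq0 invr_eq0 expf_eq0 (negPf Pk) andbF orbF.
Qed.

Lemma variety_generic_point : exists (L : fieldType) (i : {rmorphism K -> L}) (P : 'I_N.+1 -> L),
  (forall p, (peval i P p == 0) = (p \in I)) /\ cone i I P.
Proof.
have [L [i [P PE]]] := generic_point (pv_ideal I_variety) (pv_prime I_variety).
exists L, i, P; split=> //; split; last by move=> p pI; apply/eqP; rewrite PE.
by have [k kI] := pv_nonempty I_variety; exists k; rewrite -(peval_xvar i) PE.
Qed.
End Sections.

(** * Generation of forms by iterated pullbacks *)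

Section Span.
Variables (K : fieldType) (V : lmodType K).
Implicit Types (s : seq V) (p q : V).

Definition in_span s p := exists a : nat -> K, p = \sum_(i < size s) a i *: s`_i.

Lemma in_span0 s : in_span s 0.
Proof. by exists (fun=> 0); rewrite big1 // => i _; rewrite scale0r. Qed.

Lemma in_spanD s p q : in_span s p -> in_span s q -> in_span s (p + q).
Proof.
move=> [a ->] [b ->]; exists (fun i => a i + b i); rewrite -big_split.
by apply: eq_bigr => i _; rewrite scalerDl.
Qed.

Lemma in_spanZ s c p : in_span s p -> in_span s (c *: p).
Proof.
move=> [a ->]; exists (fun i => c * a i); rewrite scaler_sumr.
by apply: eq_bigr => i _; rewrite scalerA.
Qed.

Lemma in_span_mem s p : p \in s -> in_span s p.
Proof.
move=> ps; exists (fun i => (i == index p s)%:R).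
have hp : (index p s < size s)%N by rewrite index_mem.
rewrite (bigD1 (Ordinal hp)) //= eqxx scale1r nth_index // big1 ?addr0 // => i ne.
case: eqP => [e|_]; last by rewrite scale0r.
by case/eqP: ne; apply: val_inj.
Qed.

Lemma in_span_sum s (T : Type) (r : seq T) (P : pred T) (F : T -> V) :
  (forall t, P t -> in_span s (F t)) -> in_span s (\sum_(t <- r | P t) F t).
Proof.
by move=> h; elim/big_rec: _ => [|t x Pt]; [exact: in_span0|apply: in_spanD; exact: h].
Qed.
End Span.

Section Generators.
Variables (K : fieldType) (N d : nat) (f : 'I_N.+1 -> poly_ring K N).
Hypothesis d_ge2 : (2 <= d)%N.
Hypothesis f_morphism : is_morphism d f.
Implicit Types (p q : poly_ring K N).

Definition pullback p : poly_ring K N := mmap (@mpolyC N.+1 K) f p.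

Lemma pullbackM p q : pullback (p * q) = pullback p * pullback q.
Proof. exact: rmorphM. Qed.

Lemma pullbackZ c p : pullback (c *: p) = c *: pullback p.
Proof. by rewrite /pullback mmapZ mul_mpolyC. Qed.

Lemma pullback_xvar j : pullback (xvar K j) = f j.
Proof. by rewrite /pullback /xvar mmapX mmap1U. Qed.

Lemma homogeneous_pullback e p : homogeneous e p -> homogeneous (d * e) (pullback p).
Proof.
move=> pe; rewrite /pullback /mmap big_seq_cond.
apply: homogeneous_sum => m; rewrite andbT => /(homogeneous_suppE pe) <-.
rewrite mul_mpolyC; apply: homogeneousZ.
rewrite /mmap1 mdegE big_distrr /=.
elim/big_rec2: _ => [|j x y _ hx]; first exact: dhomog1.
by apply: homogeneousM => //; apply: homogeneousX; exact: f_morphism.1.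
Qed.

Lemma peval_pullback (L : fieldType) (i : {rmorphism K -> L}) (P : 'I_N.+1 -> L) p :
  peval i P (pullback p) = peval i (eval_map i f P) p.
Proof.
rewrite {1}/pullback /mmap peval_sum {2}/peval /mmap; apply: eq_bigr => m _.
rewrite pevalM; congr (_ * _); first by rewrite /peval mmapC.
rewrite /mmap1 /peval rmorph_prod; apply: eq_bigr => j _.
exact: (pevalXn i P).
Qed.

(** A monomial of degree at least (N + 1) M is divisible by some
  x_j^M = sum_l h_jl f_l, so it belongs to the ideal of the f_l with coefficients
  of degree smaller by d. The conclusion is an induction principle for additive
  properties S, which avoids writing out the decomposition. *)
Lemma pullback_generation : exists t : nat, forall n p, homogeneous n p ->
  forall S : set (poly_ring K N), S 0 -> (forall x y, S x -> S y -> S (x + y)) ->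
  (forall g q e, (mdeg g < t)%N -> homogeneous e q -> (mdeg g + d * e = n)%N ->
     S (mpolyX K g * pullback q)) -> S p.
Proof.
have [M [h [dM hhom hE]]] := xvar_nullstellensatz f_morphism.
exists (N.+1 * M)%N; elim/ltn_ind => n IH p pn S S0 SD Sg.
have Ssum : forall (T : Type) (r : seq T) (Q : pred T) (F : T -> poly_ring K N),
    (forall t, Q t -> S (F t)) -> S (\sum_(t <- r | Q t) F t).
  by move=> T r Q F hF; elim/big_rec: _ => [//|t x Qt Sx]; apply: SD => //; exact: hF.
rewrite [p]mpolyE big_seq_cond; apply: (Ssum) => m; rewrite andbT => mp.
have mn := homogeneous_suppE pn mp.
have [lt_n|ge_n] := ltnP n (N.+1 * M).
  have -> : mcoeff m p *: mpolyX K m = mpolyX K m * pullback (mpolyC _ (mcoeff m p)).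
    by rewrite /pullback mmapC mulrC mul_mpolyC.
  apply: (Sg _ _ 0%N); rewrite ?mn ?muln0 ?addn0 //.
  by rewrite -[mcoeff m p]mulr1 mpolyCM mul_mpolyC; apply: homogeneousZ; exact: dhomog1.
have [|j jm] := @large_exponent _ m M; first by rewrite mn.
have [w wm ->] := mpolyX_split K jm.
rewrite hE mulr_sumr scaler_sumr; apply: (Ssum) => l _.
rewrite mulrA scalerAl.
have M0 : (0 < M)%N by rewrite (leq_trans _ dM) // (leq_trans _ d_ge2).
have nd : (n - d = mdeg w + (M - d))%N by rewrite -mn wm addnBA.
have dn : (d <= n)%N by rewrite -mn wm (leq_trans dM) // leq_addl.
(* A product by f_l is absorbed in the pullback: (q o f) f_l = (q x_l) o f. *)
apply: (IH (n - d)%N _ (mcoeff m p *: (mpolyX K w * h j l)) _ [set u | S (u * f l)]) => /=.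
- by rewrite ltn_subrL (leq_trans _ d_ge2) // -mn wm ltn_addl.
- rewrite nd; apply: homogeneousZ; apply: homogeneousM => //; exact: homogeneous_mpolyX.
- by rewrite mul0r.
- by move=> x y Sx Sy; rewrite mulrDl; apply: SD.
- move=> g q e gt qe ge; rewrite -mulrA -pullback_xvar -pullbackM.
  apply: (Sg _ _ (e + 1)%N) => //.
    by apply: homogeneousM => //; exact: homogeneous_xvar.
  by rewrite mulnDr muln1 addnA ge subnK.
Qed.

Section Gens.
Variable t : nat.
Hypothesis generation : forall n p, homogeneous n p ->
  forall S : set (poly_ring K N), S 0 -> (forall x y, S x -> S y -> S (x + y)) ->
  (forall g q e, (mdeg g < t)%N -> homogeneous e q -> (mdeg g + d * e = n)%N ->
     S (mpolyX K g * pullback q)) -> S p.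

Definition low_monomials : seq (multinom N.+1) :=
  [seq bmnm g | g <- enum {: bmultinom N.+1 t}].

Lemma mem_low_monomials g : (g \in low_monomials) = (mdeg g < t)%N.
Proof.
apply/mapP/idP => [[b _ ->]|gt]; first exact: bmdeg.
by exists (BMultinom gt); rewrite ?mem_enum.
Qed.

(** The products g_0 * (g_1 o f) * ... of degree n with k factors g_i of degree less
  than t. *)
Fixpoint gens (k n : nat) : seq (poly_ring K N) :=
  if k is k'.+1 then
    flatten [seq if (mdeg g <= n)%N && (d %| n - mdeg g)%N
                 then [seq mpolyX K g * pullback q | q <- gens k' ((n - mdeg g) %/ d)]
                 else [::] | g <- low_monomials]
  else if n == 0%N then [:: 1] else [::].

Lemma size_gens k n : (size (gens k n) <= size low_monomials ^ k)%N.
Proof.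
elim: k n => [|k IHk] n /=; first by case: ifP.
rewrite expnS; move: (_ ^ k)%N IHk => B IHk.
elim: low_monomials => [|g s IHs] //=.
rewrite size_cat mulSn; apply: leq_add => //; case: (_ && _); rewrite ?size_map //; exact: IHk.
Qed.

Lemma gensSP k n p : p \in gens k.+1 n ->
  exists g e q, [/\ (mdeg g < t)%N, (mdeg g + d * e = n)%N, q \in gens k e &
                    p = mpolyX K g * pullback q].
Proof.
move=> /flattenP[_ /mapP[g gt ->]]; case: ifP => // /andP[gn dn] /mapP[q qk ->].
exists g, ((n - mdeg g) %/ d)%N, q; split=> //; first by rewrite -mem_low_monomials.
by rewrite [(d * _)%N]mulnC divnK // subnKC.
Qed.

Lemma gensS k g e q : (mdeg g < t)%N -> q \in gens k e ->
  mpolyX K g * pullback q \in gens k.+1 (mdeg g + d * e).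
Proof.
move=> gt qk; apply/flattenP; eexists.
  by apply/mapP; exists g; [rewrite mem_low_monomials|reflexivity].
have d0 : (0 < d)%N by apply: leq_trans d_ge2.
rewrite leq_addr addKn dvdn_mulr // mulKn //=.
by apply/mapP; exists q.
Qed.

Lemma homogeneous_gens k n p : p \in gens k n -> homogeneous n p.
Proof.
elim: k n p => [|k IHk] n p.
  by rewrite /=; case: eqP => // ->; rewrite inE => /eqP ->; exact: dhomog1.
move=> /gensSP[g [e [q [_ <- /IHk qe ->]]]].
by apply: homogeneousM; [exact: homogeneous_mpolyX|exact: homogeneous_pullback].
Qed.

(** Each pullback divides the remaining degree by d >= 2, whence the logarithmic
  number of factors. *)
Lemma gens_span k n p : (n < 2 ^ k)%N -> homogeneous n p -> in_span (gens k n) p.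
Proof.
elim: k n p => [|k IHk] n p nk pn.
  move: nk; rewrite expn0 ltnS leqn0 => /eqP n0; rewrite n0 in pn *.
  have -> : p = mcoeff (@mnm0 N.+1) p *: 1.
    apply/mpolyP => m; rewrite mcoeffZ mcoeff1 mulr_natr.
    have [->|m0] := eqVneq m (@mnm0 N.+1); first by rewrite mulr1n.
    rewrite mulr0n; apply: memN_msupp_eq0; apply: contra m0 => /(homogeneous_suppE pn)/eqP.
    by rewrite mdeg_eq0.
  by apply: in_spanZ; apply: in_span_mem; rewrite /= inE.
apply: (generation pn); first exact: in_span0.
  by move=> x y; exact: in_spanD.
move=> g q e gt qe ge.
have ek : (e < 2 ^ k)%N.
  rewrite -(ltn_pmul2l (ltn0Sn 1)) -expnS (leq_ltn_trans _ nk) // -ge.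
  by rewrite (leq_trans _ (leq_addl _ _)) // leq_mul2r d_ge2 orbT.
have [a ->] := IHk _ _ ek qe.
rewrite /pullback rmorph_sum mulr_sumr; apply: in_span_sum => i _ /=.
rewrite -/(pullback _) pullbackZ -scalerAr; apply: in_spanZ; apply: in_span_mem.
by rewrite -ge; apply: gensS => //; exact: mem_nth.
Qed.
End Gens.
End Generators.

(** * Absolute values with a weak triangle inequality *)

Section AbsoluteValue.
Variables (R : realType) (L : fieldType) (b : L -> R).
Hypothesis b_absval : is_absval b.
Implicit Types x y : L.

Let b_ge0 x : 0 <= b x := absval_ge0 b_absval x.
Let bM x y : b (x * y) = b x * b y := absvalM b_absval x y.

Lemma absval0 : b 0 = 0.
Proof. exact/(absval_eq0 b_absval). Qed.

Lemma absval_neq0 x : (b x == 0) = (x == 0).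
Proof. by apply/eqP/eqP => /(absval_eq0 b_absval). Qed.

Lemma absval_gt0 x : (0 < b x) = (x != 0).
Proof. by rewrite lt_neqAle b_ge0 andbT eq_sym absval_neq0. Qed.

Lemma absval1 : b 1 = 1.
Proof.
have b1 : b 1 != 0 by rewrite absval_neq0 oner_neq0.
by apply: (mulfI b1); rewrite -bM !mulr1.
Qed.

Lemma absvalXn x n : b (x ^+ n) = b x ^+ n.
Proof. by elim: n => [|n IHn]; rewrite ?expr0 ?absval1 // !exprS bM IHn. Qed.

Lemma absvalN x : b (- x) = b x.
Proof.
rewrite -mulN1r bM; suff -> : b (- 1) = 1 by rewrite mul1r.
by apply/eqP; rewrite -(@pexpr_eq1 _ _ 2) // -absvalXn sqrrN expr1n absval1.
Qed.

Lemma absvalV x : b x^-1 = (b x)^-1.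
Proof.
have [->|x0] := eqVneq x 0; first by rewrite invr0 absval0 invr0.
have bx : b x != 0 by rewrite absval_neq0.
by apply: (mulfI bx); rewrite -bM !divff // absval1.
Qed.

Lemma absval_prod (T : Type) (r : seq T) (P : pred T) (F : T -> L) :
  b (\prod_(t <- r | P t) F t) = \prod_(t <- r | P t) b (F t).
Proof. by elim/big_rec2: _ => [|t x y _ <-]; rewrite ?absval1 ?bM. Qed.

Section Weak.
Variable A : R.
Hypothesis A_ge1 : 1 <= A.
Hypothesis weak : forall x y, b (x + y) <= A * Num.max (b x) (b y).

(** Adding by halves: a sum of m terms costs A^(log m) rather than A^m. This keeps
  the expansion of a c x c determinant, with its c! terms, within A^(c log c). *)
Lemma absval_sum_le (T : eqType) (r : seq T) (F : T -> L) (B : R) e :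
  (size r <= 2 ^ e)%N -> 0 <= B -> (forall t, t \in r -> b (F t) <= B) ->
  b (\sum_(t <- r) F t) <= A ^+ e * B.
Proof.
move=> + B0; elim: e r => [|e IHe] r re rB.
  case: r re rB => [|t [|]] //= _ rB; rewrite ?big_nil ?absval0 ?big_seq1 mul1r //.
  by apply: rB; rewrite inE.
rewrite -(cat_take_drop (2 ^ e) r) big_cat /= (le_trans (weak _ _)) //.
rewrite exprS -mulrA ler_wpM2l ?(le_trans _ A_ge1) // ge_max; apply/andP; split.
  apply: IHe => [|t /mem_take]; last exact: rB.
  by rewrite size_take_min geq_minl.
apply: IHe => [|t /mem_drop]; last exact: rB.
by rewrite size_drop leq_subLR addnn -mul2n -expnS.
Qed.

(** Splitting the binary expansion of n in two halves: the number of digits doubles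
  at the price of one factor A. *)
Lemma absval_natr_le e n : b 2%:R <= 1 -> (n < 2 ^ (2 ^ e))%N -> b n%:R <= A ^+ e.
Proof.
move=> b2; elim: e n => [|e IHe] n.
  by case: n => [|[|n]] // _; rewrite ?absval0 ?absval1 ?expr0.
rewrite expnS mulnC expnM -mulnn => lt_n.
rewrite (divn_eq n (2 ^ 2 ^ e)) natrD natrM natrX (le_trans (weak _ _)) //.
have A0 : 0 <= A by apply: le_trans A_ge1.
rewrite exprS ler_wpM2l // ge_max; apply/andP; split.
  rewrite bM absvalXn -[leRHS]mulr1 ler_pM ?exprn_ge0 ?exprn_ile1 //.
  by apply: IHe; rewrite ltn_divLR ?expn_gt0.
by apply: IHe; rewrite ltn_mod expn_gt0.
Qed.
End Weak.
End AbsoluteValue.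

(** The tensor power trick: taking logarithms, 2^j ln x is at most (e + j) ln A for
  all j, which forces ln x <= 0. *)
Lemma le1_of_doubling (R : realType) (A x : R) e : 1 <= A -> 0 <= x ->
  (forall j, x ^+ (2 ^ j) <= A ^+ (e + j)) -> x <= 1.
Proof.
move=> A1 x0 h; rewrite leNgt; apply/negP => x1.
have l0 : 0 < ln x by exact: ln_gt0.
have a0 : 0 <= ln A by exact: ln_ge0.
have xp : 0 < x by lra.
have Ap : 0 < A by lra.
have key k : (k.+1)%:R * ln x <= (e + 2)%:R * ln A.
  have := h (2 * k)%N; rewrite -ler_ln ?posrE ?exprn_gt0 // !lnXn // -[ln x *+ _]mulr_natl -[ln A *+ _]mulr_natl => hk.
  have k2 : (k.+1 * k.+1 <= 2 ^ (2 * k))%N by rewrite mul2n -addnn expnD leq_mul // ltn_expl.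
  have e2 : (e + 2 * k <= (e + 2) * k.+1)%N by nia.
  rewrite -(ler_pM2l (ltr0Sn R k)) !mulrA -!natrM.
  apply: (@le_trans _ _ ((2 ^ (2 * k))%:R * ln x)).
    by apply: ler_wpM2r; [exact: ltW|rewrite ler_nat].
  by apply: le_trans hk _; apply: ler_wpM2r => //; rewrite ler_nat [(k.+1 * _)%N]mulnC.
have := key (Num.Def.archi_bound ((e + 2)%:R * ln A / ln x)).
apply/negP; rewrite -ltNge -ltr_pdivrMr //.
apply: lt_le_trans (archi_boundP _) _; last by rewrite ler_nat.
by rewrite divr_ge0 // ?mulr_ge0 // ltW.
Qed.

Section Ultrametric.
Variables (R : realType) (L : fieldType) (b : L -> R).
Hypothesis b_absval : is_absval b.

Lemma absval_weak : exists2 A : R, 1 <= A & forall x y, b (x + y) <= A * Num.max (b x) (b y).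
Proof.
have [A hA] := absval_add b_absval; exists (Num.max 1 A); first by rewrite le_max lexx.
move=> x y; apply: le_trans (hA x y) _; apply: ler_wpM2r; last by rewrite le_max lexx orbT.
by rewrite le_max (absval_ge0 b_absval).
Qed.

(** The norm of n^(2^j) is at most A^(n + j), whose 2^j-th root tends to 1; so
  |n| <= 1. The binomial formula for (x + y)^(2^j) then bounds |x + y|^(2^j) by
  A^(j + 1) max(|x|, |y|)^(2^j). *)
Lemma absval_ultrametric : b 2%:R <= 1 -> forall x y, b (x + y) <= Num.max (b x) (b y).
Proof.
move=> b2 x y; have [A A1 weak] := absval_weak.
have bn n : b n%:R <= 1.
  apply: (@le1_of_doubling _ A _ n) => // [|j]; first exact: absval_ge0.
  rewrite -(absvalXn b_absval) -natrX; apply: absval_natr_le => //.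
  rewrite expnD expnM ltn_exp2r ?expn_gt0 //.
  by apply: ltn_trans (ltn_expl n (ltnSn 1)) _; rewrite ltn_exp2l // ltn_expl.
set m := Num.max _ _.
have m_ge0 : 0 <= m by rewrite le_max (absval_ge0 b_absval).
have [bx0|bx0] := eqVneq m 0.
  have z t : b t <= m -> t = 0.
    rewrite bx0 => bt; apply/eqP; rewrite -(absval_neq0 b_absval) eq_le bt.
    exact: absval_ge0.
  have -> : x = 0 by apply: z; rewrite le_max lexx.
  have -> : y = 0 by apply: z; rewrite le_max lexx orbT.
  by rewrite addr0 absval0.
have m_gt0 : 0 < m by rewrite lt_neqAle eq_sym bx0.
rewrite -[leRHS]mul1r -ler_pdivrMr //.
apply: (@le1_of_doubling _ A _ 1) => // [|j].
  by rewrite divr_ge0 // ?(absval_ge0 b_absval).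
rewrite expr_div_n ler_pdivrMr ?exprn_gt0 // -(absvalXn b_absval) exprDn.
apply: absval_sum_le => //.
- rewrite /index_enum unlock -enumT size_enum_ord addnC addn1 expnS mul2n -addnn.
  by rewrite -addn1 leq_add2l expn_gt0.
- exact: exprn_ge0.
- move=> i _; rewrite -mulr_natr (absvalM b_absval) -[leRHS]mulr1.
  apply: ler_pM => //; rewrite ?(absval_ge0 b_absval) //.
  rewrite (absvalM b_absval) !(absvalXn b_absval).
  have i2 : (i <= 2 ^ j)%N by rewrite -ltnS.
  rewrite -[X in m ^+ X](subnK i2) exprD ler_pM ?exprn_ge0 ?(absval_ge0 b_absval) //.
    by rewrite lerXn2r ?nnegrE ?(absval_ge0 b_absval) // le_max lexx.
  by rewrite lerXn2r ?nnegrE ?(absval_ge0 b_absval) // le_max lexx orbT.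
Qed.
End Ultrametric.

Section Norms.
Variables (R : realType) (L : fieldType) (b : L -> R).
Hypothesis b_absval : is_absval b.
Variable A : R.
Hypothesis A_ge1 : 1 <= A.
Hypothesis weak : forall x y, b (x + y) <= A * Num.max (b x) (b y).

Lemma sup_norm_ge0 N (P : 'I_N.+1 -> L) : 0 <= sup_norm b P.
Proof. by rewrite /sup_norm; exact: bigmax_ge_id. Qed.

Lemma le_sup_norm N (P : 'I_N.+1 -> L) j : b (P j) <= sup_norm b P.
Proof. exact: le_bigmax. Qed.

Lemma sup_norm_le N (P : 'I_N.+1 -> L) (B : R) :
  0 <= B -> (forall j, b (P j) <= B) -> sup_norm b P <= B.
Proof. by move=> B0 hB; apply: bigmax_le. Qed.

Lemma sup_norm_attained N (P : 'I_N.+1 -> L) : exists j, sup_norm b P = b (P j).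
Proof.
have [j jE] : exists j, forall k, b (P k) <= b (P j).
  exists [arg max_(j > ord0) b (P j)]%O.
  by case: arg_maxP => // j _ h k; exact: h.
exists j; apply/eqP; rewrite eq_le le_sup_norm andbT.
by apply: sup_norm_le => //; exact: absval_ge0.
Qed.

Lemma sup_normZ N (P : 'I_N.+1 -> L) c :
  sup_norm b (fun j => c * P j) = b c * sup_norm b P.
Proof.
apply/eqP; rewrite eq_le; apply/andP; split.
  apply: sup_norm_le => [|j]; first by rewrite mulr_ge0 ?(absval_ge0 b_absval) ?sup_norm_ge0.
  by rewrite (absvalM b_absval) ler_wpM2l ?(absval_ge0 b_absval) ?le_sup_norm.
have [j ->] := sup_norm_attained P; rewrite -(absvalM b_absval).
exact: (le_sup_norm (fun j => c * P j)).
Qed.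

Lemma absval_monomial_le N (P : 'I_N.+1 -> L) (m : multinom N.+1) :
  b (mmap1 P m) <= sup_norm b P ^+ mdeg m.
Proof.
rewrite /mmap1 (absval_prod b_absval) mdegE -prodrXr.
apply: ler_prod => j _; rewrite (absvalXn b_absval) exprn_ge0 ?(absval_ge0 b_absval) //=.
by rewrite lerXn2r ?nnegrE ?sup_norm_ge0 ?(absval_ge0 b_absval) // le_sup_norm.
Qed.

Lemma absval_peval_le (K : fieldType) N (i : {rmorphism K -> L}) (P : 'I_N.+1 -> L) (p : poly_ring K N) e :
  homogeneous e p ->
  b (peval i P p) <= A ^+ size (msupp p) * (\prod_(m <- msupp p) Num.max 1 (b (i (mcoeff m p))))
     * sup_norm b P ^+ e.
Proof.
move=> pe; rewrite -mulrA; apply: absval_sum_le => //.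
- exact/ltnW/ltn_expl.
- by rewrite mulr_ge0 ?exprn_ge0 ?sup_norm_ge0 // prodr_ge0 // => m _; rewrite le_max ler01.
move=> m mp; rewrite (absvalM b_absval) ler_pM ?(absval_ge0 b_absval) //; last first.
  by rewrite -(homogeneous_suppE pe mp) absval_monomial_le.
rewrite (big_rem m) //= -[leLHS]mulr1; apply: ler_pM => //; first exact: absval_ge0.
  by rewrite le_max lexx orbT.
elim/big_rec: _ => [|k x _ x1] //.
by rewrite -[leLHS]mulr1; apply: ler_pM => //; rewrite le_max lexx.
Qed.

Lemma absval_det_le c l (M : 'M[L]_c) (B : R) : (c <= 2 ^ l)%N -> 0 <= B ->
  (forall i j, b (M i j) <= B) -> b (\det M) <= A ^+ (l * c) * B ^+ c.
Proof.
move=> cl B0 MB; apply: absval_sum_le => //; last 2 first.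
- exact: exprn_ge0.
- move=> s _; rewrite (absvalM b_absval) (absvalXn b_absval) (absvalN b_absval) (absval1 b_absval) expr1n mul1r.
  rewrite (absval_prod b_absval) -[X in B ^+ X]card_ord -prodr_const.
  by apply: ler_prod => i _; rewrite (absval_ge0 b_absval) MB.
rewrite /index_enum unlock -enumT -cardE card_Sn expnM.
have : (c`! <= c ^ c)%N.
  rewrite fact_prod big_add1 /= big_mkord -[X in (_ <= _ ^ X)%N]card_ord -prod_nat_const.
  by apply: leq_prod => i _; exact: ltn_ord.
by move=> /leq_trans; apply; have [->|c0] := posnP c; [rewrite !expn0|rewrite leq_exp2r].
Qed.
End Norms.

(** * Linear algebra on the sections *)

Section BasisChange.
Variables (K : fieldType) (N : nat) (I : {pred poly_ring K N}).
Hypothesis I_variety : projective_variety I.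

(** Stated through values at all points of the cone, the form in which it is used;
  forms and arbitrary sections can then be treated alike. *)
Definition spans_sections n r (s : 'I_r -> cochain K N) :=
  forall t, is_section I n t -> exists a : 'I_r -> K,
    forall (L : fieldType) (i : {rmorphism K -> L}) (P : 'I_N.+1 -> L), cone i I P ->
      section_eval i t P = \sum_k i (a k) * section_eval i (s k) P.

Lemma basis_spans n c (eta : 'I_c -> cochain K N) :
  is_basis I n eta -> spans_sections n eta.
Proof.
move=> [_ _ span] t /span[a ta]; exists a => L i P Pcone.
by rewrite (section_eval_eq Pcone ta) section_eval_lincomb.
Qed.

(** Let A express eta in terms of s, and B express s in terms of eta. The freeness
  of eta gives A B = 1, so B has rank c and c of its rows form an invertible
  matrix; delta is its determinant. *)
Lemma basis_change n c (eta : 'I_c -> cochain K N) r (s : 'I_r -> cochain K N) :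
  is_basis I n eta -> (forall k, is_section I n (s k)) -> spans_sections n s ->
  (c <= r)%N /\ exists (phi : 'I_c -> 'I_r) (delta : K), delta != 0 /\
    forall (L : fieldType) (i : {rmorphism K -> L}) (P : 'I_c -> 'I_N.+1 -> L),
      (forall k, cone i I (P k)) ->
      \det (\matrix_(k < c, j < c) section_eval i (eta j) (P k)) * i delta =
      \det (\matrix_(k < c, j < c) section_eval i (s (phi j)) (P k)).
Proof.
move=> basis sn span.
have /choice[A AE] j := span _ (let: And3 h _ _ := basis in h j).
have /choice[B BE] k := basis_spans basis (sn k).
pose MA : 'M[K]_(c, r) := \matrix_(j, k) A j k.
pose MB : 'M[K]_(r, c) := \matrix_(k, j) B k j.
have AB : MA *m MB = 1%:M.
  have [L [i [P [PE Pcone]]]] := variety_generic_point I_variety.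
  apply/matrixP => j l; apply/eqP; rewrite -subr_eq0; apply/eqP.
  pose a l := (MA *m MB) j l - (1%:M : 'M[K]_c) j l.
  apply: (basis_free I_variety basis PE Pcone (a := a)).
  rewrite /a (eq_bigr (fun l => i ((MA *m MB) j l) * section_eval i (eta l) P -
    i ((1%:M : 'M[K]_c) j l) * section_eval i (eta l) P)); last first.
    by move=> k _; rewrite rmorphB mulrBl.
  rewrite sumrB; apply/eqP; rewrite subr_eq0; apply/eqP.
  rewrite [RHS](bigD1 j) //= mxE eqxx rmorph1 mul1r [X in _ + X]big1 ?addr0; last first.
    by move=> k kj; rewrite mxE eq_sym (negPf kj) rmorph0 mul0r.
  rewrite AE //; under [RHS]eq_bigr => k _ do rewrite BE // mulr_sumr.
  rewrite exchange_big; apply: eq_bigr => k _ /=.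
  rewrite mxE rmorph_sum mulr_suml; apply: eq_bigr => q _.
  by rewrite !mxE rmorphM mulrA.
split; first exact: mulmx1_min AB.
have fullB : row_full MB.
  by rewrite -sub1mx -AB submxMl.
pose phi := fullrankfun fullB; pose D := rowsub phi MB.
have unitD : D \in unitmx by rewrite -row_full_unit; exact: fullrowsub_full.
exists phi, (\det D); split; first by rewrite -unitfE -unitmxE.
move=> L i P Pcone.
rewrite -det_map_mx -[\det (map_mx _ _)]det_tr -det_mulmx; congr (\det _).
apply/matrixP => k j; rewrite !mxE BE //; apply: eq_bigr => l _.
by rewrite !mxE mulrC.
Qed.

Lemma spans_sections_poly n (g : seq (poly_ring K N)) :
  (forall t, is_section I n t -> exists2 p, homogeneous n p & section_eq I t (poly_section p)) ->
  (forall p, homogeneous n p -> in_span g p) ->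
  spans_sections n (fun k : 'I_(size g) => poly_section g`_k).
Proof.
move=> large span t /large[p /span[a pE] tp]; exists a => L i P Pcone.
have evalE q : section_eval i (poly_section q) P = peval i P q.
  by apply: section_eval_poly; case: Pcone.
rewrite (section_eval_eq Pcone tp) evalE pE peval_sum.
by apply: eq_bigr => k _; rewrite pevalZ evalE.
Qed.
End BasisChange.

(** * Sums over the places *)

Section PlaceSum.
Variables (R : realType) (M : choiceType).

Lemma place_sum_le (r : seq M) (h : M -> \bar R) (u : M -> R) :
  uniq r -> (forall v, v \notin r -> u v = 0) -> (forall v, (h v <= (u v)%:E)%E) ->
  (place_sum h <= (\sum_(v <- r) u v)%:E)%E.
Proof.
move=> r_uniq u0 hu.
pose up v := Num.max (u v) 0; pose un v := Num.max (- u v) 0.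
have sum_r (w : M -> R) : (\sum_(v \in [set` r]) (w v)%:E = (\sum_(v <- r) w v)%:E)%E.
  by rewrite -fsbig_seq // sumEFin.
have pos : (\esum_(v in [set: M]) (h^\+)%E v <= (\sum_(v <- r) up v)%:E)%E.
  apply: (@le_trans _ _ (\esum_(v in [set: M]) (up v)%:E)%E).
    apply: le_esum => v _; rewrite funeposE /up EFin_max.
    by rewrite ge_max !le_max hu lexx orbT.
  rewrite -sum_r -esum_fset //; first last.
  - by move=> v _; rewrite lee_fin /up le_max lexx orbT.
  rewrite [leRHS]esum_mkcond; apply: le_esum => v _.
  by rewrite mem_setE; case: ifPn => // /u0; rewrite /up => ->; rewrite maxxx.
have neg : ((\sum_(v <- r) un v)%:E <= \esum_(v in [set: M]) (h^\-)%E v)%E.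
  apply: esum_ge; exists [set` r]; first by split.
  rewrite -sum_r; apply: lee_fsum => // v _.
  rewrite funenegE /un EFin_max ge_max !le_max lexx orbT andbT EFinN leeN2 hu //.
have pos0 : (0 <= \esum_(v in [set: M]) (h^\+)%E v)%E.
  by apply: esum_ge0 => v _; exact: funepos_ge0.
have -> : \sum_(v <- r) u v = \sum_(v <- r) up v - \sum_(v <- r) un v.
  rewrite -sumrB; apply: eq_bigr => v _; rewrite /up /un.
  by case: (ltP (u v) 0); case: (ltP (- u v) 0) => *; lra.
rewrite /place_sum; move: pos pos0 neg.
case: (\esum_(v in _) _)%E => [x||] //; case: (\esum_(v in _) _)%E => [y||] //=.
- rewrite !lee_fin; lra.
- by rewrite leNye.
Qed.

(** The families of constants that occur in bounds holding at all places: their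
  logarithms have a finite sum. *)
Definition place_const (D : M -> R) :=
  (forall v, 1 <= D v) /\ finite_set [set v | D v != 1].

Lemma place_const1 : place_const (fun=> 1).
Proof.
split=> //; rewrite (_ : [set v | _] = set0) //.
by apply/seteqP; split=> // v /=; rewrite eqxx.
Qed.

Lemma place_constM D E : place_const D -> place_const E -> place_const (fun v => D v * E v).
Proof.
move=> [D1 Dfin] [E1 Efin]; split=> [v|].
  by rewrite -[1]mulr1 ler_pM.
apply: (@sub_finite_set _ _ ([set v | D v != 1] `|` [set v | E v != 1])).
  move=> v /=; have [-> | ] := eqVneq (D v) 1; last by left.
  by rewrite mul1r; right.
by rewrite finite_setU.
Qed.

Lemma place_constX D n : place_const D -> place_const (fun v => D v ^+ n).
Proof.
move=> hD; elim: n => [|n IHn].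
  by under eq_fun do rewrite expr0; exact: place_const1.
by under eq_fun do rewrite exprS; exact: place_constM.
Qed.

Lemma place_const_prod (T : Type) (r : seq T) (P : pred T) (F : T -> M -> R) :
  (forall t, place_const (F t)) -> place_const (fun v => \prod_(t <- r | P t) F t v).
Proof.
move=> hF; elim: r => [|t r IHr].
  by under eq_fun do rewrite big_nil; exact: place_const1.
under eq_fun do rewrite big_cons; case: (P t) => //; exact: place_constM.
Qed.

Definition log_total (D : M -> R) := \sum_(v \in [set: M]) ln (D v).

Lemma log_totalE D (r : seq M) : uniq r -> (forall v, D v != 1 -> v \in r) ->
  log_total D = \sum_(v <- r) ln (D v).
Proof.
move=> ru Dr; rewrite /log_total (fsbigE r) //; first by apply: eq_bigl => v; rewrite mem_set.
move=> v _ vr; have [->|/Dr] := eqVneq (D v) 1; first exact: ln1.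
by rewrite (negPf vr).
Qed.

Lemma log_total_ge0 D : place_const D -> 0 <= log_total D.
Proof. by move=> [D1 _]; apply: fsumr_ge0 => v _; exact: ln_ge0. Qed.

Lemma place_const_seq D : place_const D ->
  exists r : seq M, uniq r /\ forall v, D v != 1 -> v \in r.
Proof.
move=> [_ Dfin]; exists (finmap.enum_fset (fset_set [set v | D v != 1])); split=> [|v Dv].
  exact: finmap.fset_uniq.
by rewrite [_ \in _]in_fset_set // inE.
Qed.

Lemma log_totalX D n : place_const D -> log_total (fun v => D v ^+ n) = n%:R * log_total D.
Proof.
move=> hD; have [r [ru rD]] := place_const_seq hD.
rewrite !(log_totalE ru) //; last first.
  by move=> v h; apply: rD; apply: contra h => /eqP ->; rewrite expr1n.
rewrite mulr_sumr; apply: eq_bigr => v _; rewrite lnXn ?mulr_natl //.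
by case: hD => D1 _; apply: lt_le_trans (D1 v).
Qed.
End PlaceSum.

Section Places.
Variables (R : realType) (K : fieldType) (M : choiceType) (av : M -> K -> R).
Hypothesis Kpff : product_formula_field av.
Variable Cv : forall v : M, complex_field (av v).

Lemma cf_abs_absval v : is_absval (@cf_abs _ _ _ (Cv v)).
Proof. by have [] := cf_sortP (Cv v). Qed.

Lemma cf_abs_embed v x : cf_abs (cf_embed (Cv v) x) = av v x.
Proof.
have [_ h1 _ _] := cf_sortP (Cv v); have [_ h2 _ _] := cf_complP (Cv v).
by rewrite /cf_embed /= h1 cf_alg_ext h2.
Qed.

Lemma place_const_coef (x : K) : place_const (fun v => Num.max 1 (av v x)).
Proof.
split=> [v|]; first by rewrite le_max lexx.
have [->|x0] := eqVneq x 0.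
  rewrite (_ : [set v | _] = set0) //; apply/seteqP; split=> // v /=.
  by rewrite (absval0 (pff_absval Kpff v)) max_l ?eqxx.
apply: sub_finite_set (pff_finite Kpff x0) => v /=.
by apply: contra => /eqP ->; rewrite maxxx.
Qed.

(** At a place with |2| <= 1 the constant is 1. If 2 is nonzero in K, the other
  places are finite in number by the axioms; if 2 = 0 there are none. *)
Lemma place_const_weak : exists A : M -> R, place_const A /\
  forall v (x y : Cv v), cf_abs (x + y) <= A v * Num.max (cf_abs x) (cf_abs y).
Proof.
have /choice[A hA] : forall v, exists a : R, [/\ 1 <= a,
    (forall x y : Cv v, cf_abs (x + y) <= a * Num.max (cf_abs x) (cf_abs y))
    & av v 2%:R <= 1 -> a = 1].
  move=> v; have [h|h] := leP (av v 2%:R) 1; last first.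
    by have [a a1 ha] := absval_weak (cf_abs_absval v); exists a; split.
  exists 1; split=> // x y; rewrite mul1r.
  by apply: absval_ultrametric; [exact: cf_abs_absval|rewrite -(rmorph_nat (cf_embed (Cv v))) cf_abs_embed].
exists A; split; last by move=> v; case: (hA v).
split=> [v|]; first by case: (hA v).
apply: sub_finite_set (place_const_coef 2%:R).2 => v /= Av.
by apply: contra Av => /eqP m1; case: (hA v) => _ _ -> //; rewrite -m1 le_max lexx orbT.
Qed.

Lemma product_formula_log (x : K) (r : seq M) : x != 0 -> uniq r ->
  (forall v, av v x != 1 -> v \in r) -> \sum_(v <- r) ln (av v x) = 0.
Proof.
move=> x0 ru xr; have := pff_product Kpff x0.
rewrite (fsbigE r) //; last first.
  by move=> v _ vr; have [//|/xr] := eqVneq (av v x) 1; rewrite (negPf vr).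
rewrite (eq_bigl xpredT) => [prod1|v]; last by rewrite mem_set.
rewrite -[RHS]ln1 -prod1.
suff [_ ->] : 0 < \prod_(v <- r) av v x /\
  ln (\prod_(v <- r) av v x) = \sum_(v <- r) ln (av v x) by [].
elim: (r) => [|v s [IHpos IH]]; first by rewrite !big_nil ln1.
have pos : 0 < av v x by rewrite absval_gt0 //; exact: pff_absval Kpff v.
by rewrite !big_cons mulr_gt0 // lnM ?posrE // IH.
Qed.
End Places.

(** * Orbits in the filled Julia set *)

Section Orbits.
Variables (R : realType) (K : fieldType) (N d : nat) (f F : 'I_N.+1 -> poly_ring K N).
Hypothesis d_ge2 : (2 <= d)%N.
Hypothesis f_morphism : is_morphism d f.
Variable kappa : K.
Hypothesis kappa_neq0 : kappa != 0.
Hypothesis FE : forall j, F j = kappa *: f j.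
Variables (L : fieldType) (b : L -> R) (i : {rmorphism K -> L}).
Hypothesis b_absval : is_absval b.
Variables (rho B : R).
Hypothesis rho_gt0 : 0 < rho.
Hypothesis rho_kappa : rho ^+ d.-1 * b (i kappa) = 1.
Hypothesis B_ge1 : 1 <= B.
Hypothesis growth : forall P : 'I_N.+1 -> L, sup_norm b P ^+ d <= B * sup_norm b (eval_map i f P).

Let kappa_gt0 : 0 < b (i kappa).
Proof. by rewrite absval_gt0 // fmorph_eq0. Qed.

Let B_gt0 : 0 < B.
Proof. exact: lt_le_trans B_ge1. Qed.

Lemma eval_map_lift P : eval_map i F P = fun j => i kappa * eval_map i f P j.
Proof. by apply/funext => j; rewrite /eval_map FE pevalZ. Qed.

(** In the unit of length rho, the lift F satisfies the growth inequality of f. *)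
Lemma escape_step (P : 'I_N.+1 -> L) :
  (sup_norm b P / rho) ^+ d <= B * (sup_norm b (eval_map i F P) / rho).
Proof.
rewrite eval_map_lift (sup_normZ b_absval) expr_div_n.
have d0 : d = d.-1.+1 by rewrite prednK // (leq_trans _ d_ge2).
rewrite {2}d0 exprSr ler_pdivrMr ?mulr_gt0 ?exprn_gt0 //.
apply: le_trans (growth P) _; rewrite le_eqVlt; apply/orP; left; apply/eqP.
transitivity (B * (rho ^+ d.-1 * b (i kappa)) * sup_norm b (eval_map i f P)).
  by rewrite rho_kappa mulr1.
by field; rewrite gt_eqF.
Qed.

(** Once ||P|| > rho B, each step multiplies the norm by at least
  q = ||P|| / (rho B) > 1, since the degree d is at least 2; the orbit tends to
  infinity. *)
Lemma filled_julia_norm_le (P : 'I_N.+1 -> L) :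
  ~ (sup_norm b (iter k (eval_map i F) P) @[k --> \oo] --> +oo) ->
  sup_norm b P <= rho * B.
Proof.
apply: contra_notP => /negP; rewrite -ltNge => big.
pose z k := sup_norm b (iter k (eval_map i F) P) / rho.
have z0B : B < z 0%N by rewrite /z /= ltr_pdivlMr // mulrC.
pose q := z 0%N / B.
have q1 : 1 < q by rewrite /q ltr_pdivlMr // mul1r.
have z_growth k : z 0%N * q ^+ k <= z k.
  elim: k => [|k IHk]; first by rewrite mulr1.
  have z0_ge1 : 1 <= z 0%N by rewrite (le_trans B_ge1) // ltW.
  have zk : z 0%N <= z k.
    by apply: le_trans IHk; rewrite ler_peMr ?(le_trans _ z0_ge1) // exprn_ege1 // ltW.
  have := escape_step (iter k (eval_map i F) P).
  rewrite -iterS -/(z k) -/(z k.+1) => step.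
  rewrite -(ler_pM2l B_gt0); apply: le_trans step.
  have zk_ge1 : 1 <= z k by apply: le_trans zk.
  apply: (@le_trans _ _ (z k ^+ 2)); last exact: ler_weXn2l.
  rewrite exprSr expr2 (_ : B * _ = (z 0%N * q ^+ k) * z 0%N); last first.
    by rewrite {2}/q; field; rewrite gt_eqF.
  apply: ler_pM => //; first by rewrite mulr_ge0 ?exprn_ge0 ?(le_trans _ z0_ge1) // ltW // (lt_trans _ q1).
  exact: le_trans ler01 z0_ge1.
have bernoulli k : k%:R * (q - 1) <= q ^+ k.
  elim: k => [|k IHk]; first by rewrite mul0r.
  have qk : 1 <= q ^+ k by apply: exprn_ege1; exact: ltW.
  rewrite exprS -natr1; nra.
apply/cvgryPge => a.
exists (Num.Def.archi_bound `|a / (rho * z 0%N * (q - 1))|) => // k /= hk.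
have z0_gt0 : 0 < z 0%N by apply: lt_trans z0B.
have -> : sup_norm b (iter k (eval_map i F) P) = rho * z k.
  by rewrite /z mulrC divfK // gt_eqF.
have q10 : 0 < q - 1 by rewrite subr_gt0.
apply: (@le_trans _ _ (rho * (z 0%N * (k%:R * (q - 1))))); last first.
  rewrite ler_pM2l //; apply: le_trans (z_growth k).
  by rewrite ler_pM2l.
have pos : 0 < rho * z 0%N * (q - 1) := mulr_gt0 (mulr_gt0 rho_gt0 z0_gt0) q10.
have -> : rho * (z 0%N * (k%:R * (q - 1))) = k%:R * (rho * z 0%N * (q - 1)) by ring.
rewrite -ler_pdivrMr //.
apply: le_trans (ler_norm _) _; apply: ltW; apply: lt_le_trans (archi_boundP (normr_ge0 _)) _.
by rewrite ler_nat.
Qed.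

Lemma filled_julia_orbit_le (P : 'I_N.+1 -> L) :
  ~ (sup_norm b (iter k (eval_map i F) P) @[k --> \oo] --> +oo) ->
  forall k, sup_norm b (iter k (eval_map i F) P) <= rho * B.
Proof.
move=> nP k; apply: filled_julia_norm_le; apply: contra_not nP => /cvgryPge big.
apply/cvgryPge => a; have [m _ hm] := big a.
exists (m + k)%N => // l /= ml.
have kl : (k <= l)%N by apply: leq_trans ml; rewrite leq_addl.
by have := hm (l - k)%N; rewrite /= -iterD subnK //; apply; rewrite leq_subRL // addnC.
Qed.

Lemma peval_scale c (P : 'I_N.+1 -> L) (p : poly_ring K N) e : homogeneous e p ->
  peval i (fun j => c * P j) p = c ^+ e * peval i P p.
Proof.
move=> pe; rewrite /peval /mmap mulr_sumr big_seq [RHS]big_seq; apply: eq_bigr => m mp.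
rewrite mulrCA; congr (_ * _); rewrite -(homogeneous_suppE pe mp) mdegE.
rewrite -prodrXr -big_split; apply: eq_bigr => j _ /=; exact: exprMn.
Qed.

(** The factor g_l of the product is evaluated at the l-th point of the orbit of f,
  which is a multiple of the l-th point of the orbit of F. The powers of kappa that
  this introduces combine with the radius rho into rho^n exactly, because the
  product is a form of degree n. *)
Lemma gens_bound t k n q (P : 'I_N.+1 -> L) : q \in gens d f t k n ->
  (forall l, sup_norm b (iter l (eval_map i F) P) <= rho * B) ->
  b (peval i P q) <= rho ^+ n * B ^+ (t * k).
Proof.
elim: k n q P => [|k IHk] n q P.
  rewrite /=; case: eqP => // ->; rewrite inE => /eqP -> _.
  by rewrite peval1 absval1 // muln0 !expr0 mulr1.
move=> /gensSP[g [e [q' [gt <- q'k ->]]]] orbit.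
rewrite pevalM (absvalM b_absval) exprD mulnS exprD mulrACA.
apply: ler_pM; rewrite ?(absval_ge0 b_absval) //.
  have rB0 : 0 <= rho * B by rewrite ltW // mulr_gt0.
  apply: (@le_trans _ _ ((rho * B) ^+ mdeg g)).
    rewrite /peval mmapX; apply: le_trans (absval_monomial_le b_absval P g) _.
    apply: lerXn2r; rewrite ?nnegrE ?sup_norm_ge0 //; exact: (orbit 0%N).
  rewrite exprMn ler_pM2l ?exprn_gt0 //; apply: ler_weXn2l => //; exact: ltnW.
rewrite peval_pullback.
have -> : eval_map i f P = fun j => (i kappa)^-1 * eval_map i F P j.
  by apply/funext => j; rewrite eval_map_lift mulrA mulVf ?mul1r // fmorph_eq0.
rewrite (peval_scale _ _ (homogeneous_gens f_morphism q'k)) (absvalM b_absval).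
have -> : rho ^+ (d * e) = b ((i kappa)^-1 ^+ e) * rho ^+ e.
  rewrite (absvalXn b_absval) (absvalV b_absval) -exprMn exprM; congr (_ ^+ _).
  have {1}-> : d = d.-1.+1 by rewrite prednK // (leq_trans _ d_ge2).
  rewrite exprSr; congr (_ * _); rewrite -[RHS]mul1r -rho_kappa mulfK // gt_eqF //.
rewrite -mulrA ler_wpM2l ?(absval_ge0 b_absval) //; apply: IHk => // l.
by rewrite -iterSr; exact: orbit.
Qed.
End Orbits.

(** * Bounds valid at all places *)

Section PlaceBounds.
Variables (R : realType) (K : fieldType) (M : choiceType) (av : M -> K -> R).
Hypothesis Kpff : product_formula_field av.
Variable Cv : forall v : M, complex_field (av v).
Variable A : M -> R.
Hypothesis A_const : place_const A.
Hypothesis A_weak : forall v (x y : Cv v),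
  cf_abs (x + y) <= A v * Num.max (cf_abs x) (cf_abs y).
Variable N : nat.
Local Notation norm := (sup_norm (@cf_abs _ _ _ _)).

Lemma le_prod_place_const (T : finType) (F : T -> M -> R) t v :
  (forall t, place_const (F t)) -> F t v <= \prod_t F t v.
Proof.
move=> hF; rewrite (bigD1 t) //= ler_peMr //; first by apply: le_trans ler01 _; case: (hF t).
by elim/big_rec: _ => // u x _ x1; rewrite -[1]mulr1 ler_pM //; case: (hF u).
Qed.

Lemma place_peval_bound (p : poly_ring K N) e : homogeneous e p ->
  exists H, place_const H /\ forall v (P : 'I_N.+1 -> Cv v),
    cf_abs (peval (cf_embed (Cv v)) P p) <= H v * norm P ^+ e.
Proof.
move=> pe; exists (fun v => A v ^+ size (msupp p) *
  \prod_(m <- msupp p) Num.max 1 (av v (mcoeff m p))); split.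
  apply: place_constM; first exact: place_constX.
  by apply: place_const_prod => m; exact: place_const_coef.
move=> v P; have := absval_peval_le (cf_abs_absval Cv v) (A_const.1 v) (@A_weak v)
  (cf_embed (Cv v)) P pe.
by under eq_bigr do rewrite cf_abs_embed.
Qed.

(** At the index i where |P_i| = ||P||, evaluate x_i^m = sum_j h_ij f_j: this gives
  ||P||^m <= B ||P||^(m - d) ||f(P)||. *)
Lemma place_growth d (f : 'I_N.+1 -> poly_ring K N) : is_morphism d f -> (0 < d)%N ->
  exists B, place_const B /\ forall v (P : 'I_N.+1 -> Cv v),
    norm P ^+ d <= B v * norm (eval_map (cf_embed (Cv v)) f P).
Proof.
move=> f_morphism d0.
have [m [h [dm hhom hE]]] := xvar_nullstellensatz f_morphism.
have /choice[H HP] (ij : 'I_N.+1 * 'I_N.+1) := place_peval_bound (hhom ij.1 ij.2).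
have Hc ij : place_const (H ij) by case: (HP ij).
exists (fun v => A v ^+ N.+1 * \prod_ij H ij v); split.
  by apply: place_constM; [exact: place_constX|exact: place_const_prod].
move=> v P; have b_absval := cf_abs_absval Cv v.
have [P0|P0] := eqVneq (norm P) 0.
  rewrite P0 expr0n gtn_eqF //= mulr_ge0 ?sup_norm_ge0 // mulr_ge0 //.
    by rewrite exprn_ge0 // (le_trans ler01) //; case: A_const.
  by apply: prodr_ge0 => ij _; apply: le_trans ler01 _; case: (Hc ij).
have Pgt0 : 0 < norm P by rewrite lt_neqAle eq_sym P0 sup_norm_ge0.
have [i iE] := sup_norm_attained b_absval P.
rewrite -(ler_pM2l (exprn_gt0 (m - d) Pgt0)) -exprD subnK // {1}iE -(absvalXn b_absval).
have -> : P i ^+ m = \sum_j peval (cf_embed (Cv v)) P (h i j) * eval_map (cf_embed (Cv v)) f P j.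
  rewrite -(peval_xvar (cf_embed (Cv v))) -pevalXn hE peval_sum.
  by apply: eq_bigr => j _; rewrite pevalM.
rewrite mulrA mulrCA -mulrA -mulrA.
apply: (absval_sum_le b_absval (A_const.1 v) (@A_weak v)).
- by rewrite /index_enum unlock -enumT size_enum_ord ltnW // ltn_expl.
- rewrite !mulr_ge0 ?exprn_ge0 ?sup_norm_ge0 //.
  by apply: prodr_ge0 => ij _; apply: le_trans ler01 _; case: (Hc ij).
move=> j _; rewrite (absvalM b_absval) mulrA; apply: ler_pM; rewrite ?(absval_ge0 b_absval) //.
  apply: le_trans ((HP (i, j)).2 v P) _; rewrite mulrC ler_wpM2l ?exprn_ge0 ?sup_norm_ge0 //.
  exact: (le_prod_place_const (i, j)).
exact: le_sup_norm.
Qed.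

(** On the chart where |P_j| = ||P||, the denominator is a power of ||P||. *)
Lemma place_section_bound (I : {pred poly_ring K N}) n (s : cochain K N) :
  projective_variety I -> is_section I n s ->
  exists H, place_const H /\ forall v (P : 'I_N.+1 -> Cv v), cone (cf_embed (Cv v)) I P ->
    cf_abs (section_eval (cf_embed (Cv v)) s P) <= H v * norm P ^+ n.
Proof.
move=> I_variety sn.
have /choice[H HP] j := place_peval_bound (sn.1 j).
have Hc j : place_const (H j) by case: (HP j).
exists (fun v => \prod_j H j v); split; first exact: place_const_prod.
move=> v P Pcone; have b_absval := cf_abs_absval Cv v.
have [j jE] := sup_norm_attained b_absval P.
have Pj : P j != 0.
  have [[k Pk] _] := Pcone; rewrite -(absval_neq0 b_absval) -jE gt_eqF //.
  by rewrite (lt_le_trans _ (le_sup_norm _ _ k)) // absval_gt0.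
rewrite (section_eval_chart I_variety Pcone sn Pj) (absvalM b_absval) (absvalV b_absval).
rewrite (absvalXn b_absval) -jE ler_pdivrMr ?exprn_gt0 ?jE ?absval_gt0 // -jE.
apply: le_trans ((HP j).2 v P) _; rewrite exprD mulrA ler_wpM2r ?exprn_ge0 ?sup_norm_ge0 //.
by rewrite ler_wpM2r ?exprn_ge0 ?sup_norm_ge0 // le_prod_place_const.
Qed.

Lemma lne_sectional_d_le v n c (eta : 'I_c -> cochain K N) (E : set ('I_N.+1 -> Cv v)) (u : R) :
  (0 < n)%N -> (0 < c)%N ->
  (forall P : 'I_c -> 'I_N.+1 -> Cv v, (forall i, E (P i)) ->
     let D := \det (\matrix_(i < c, j < c) section_eval (cf_embed (Cv v)) (eta j) (P i)) in
     D != 0 -> ln (cf_abs D) <= (n * c)%:R * u) ->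
  (lne (sectional_d n eta E) <= u%:E)%E.
Proof.
move=> n0 c0 h; rewrite /sectional_d expeRK; apply: ge_ereal_sup => _ [P EP <-].
have nc : 0 < (n * c)%:R :> R by rewrite ltr0n muln_gt0 n0.
have := h P EP; set D := \det _ => /= hD; rewrite /lne; case: ifPn => D0.
  by rewrite mulrNy gtr0_sg ?invr_gt0 // mul1e leNye.
rewrite -EFinM lee_fin ler_pdivrMl //; apply: hD.
by rewrite -(absval_gt0 (cf_abs_absval Cv v)) ltNge.
Qed.

(** The absolute value of the scalars alpha with alpha^(d-1) kappa = 1, for which
  P |-> alpha P conjugates f to F = kappa f. *)
Definition julia_radius d (kappa : K) v := expR (- ln (av v kappa) / d.-1%:R) : R.

Lemma julia_radiusE d kappa v : (2 <= d)%N -> kappa != 0 ->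
  julia_radius d kappa v ^+ d.-1 * av v kappa = 1.
Proof.
move=> d2 k0; have d1 : (d.-1)%:R != 0 :> R by rewrite pnatr_eq0 -lt0n; case: d d2 => [|[]].
rewrite /julia_radius -expRM_natl [_%:R * _]mulrC divfK // expRN lnK ?mulVf //.
  by rewrite (absval_neq0 (pff_absval Kpff v)).
by rewrite posrE (absval_gt0 (pff_absval Kpff v)).
Qed.

(** At each place, the logarithm of the capacity is at most
  log rho + (l log A + log D) / n - log |delta| / (n c), where delta relates the
  determinants of eta and of a subfamily of s. Summed over the places, the terms in
  kappa (through rho) and in delta vanish by the product formula. *)
Lemma place_sum_estimate (I : {pred poly_ring K N}) d (F : 'I_N.+1 -> poly_ring K N) (kappa : K)
    n c (eta : 'I_c -> cochain K N) r (s : 'I_r -> cochain K N) l (D : M -> R) :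
  projective_variety I -> (2 <= d)%N -> (0 < n)%N -> kappa != 0 ->
  is_basis I n eta -> (forall k, is_section I n (s k)) -> spans_sections I n s ->
  (r <= 2 ^ l)%N -> place_const D ->
  (forall v P k, filled_julia (Cv v) F P -> cone (cf_embed (Cv v)) I P ->
    cf_abs (section_eval (cf_embed (Cv v)) (s k) P) <= julia_radius d kappa v ^+ n * D v) ->
  (place_sum (fun v => lne (sectional_d n eta
      (filled_julia (Cv v) F `&` cone (cf_embed (Cv v)) I)))
    <= ((l%:R * log_total A + log_total D) / n%:R)%:E)%E.
Proof.
move=> I_variety d2 n0 k0 basis sn span rl Dc bound.
have d1 : (d.-1)%:R != 0 :> R by rewrite pnatr_eq0 -lt0n -ltnS prednK ?(ltnW d2).
have n_gt0 : 0 < n%:R :> R by rewrite ltr0n.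
(* For c = 0 the normalizing factor 1 / (n c) is 0, and so is every logarithm. *)
have [c0|c_gt0] := posnP c.
  apply: (@le_trans _ _ (\sum_(v <- ([::] : seq M)) (fun=> 0 : R) v)%:E%E).
    apply: place_sum_le => // v; rewrite /sectional_d expeRK; apply: ge_ereal_sup => _ [P _ <-].
    by rewrite (_ : (n * c)%N = 0%N) ?invr0 ?mul0e // c0 muln0.
  rewrite big_nil lee_fin divr_ge0 ?(ltW n_gt0) //.
  by rewrite addr_ge0 ?mulr_ge0 ?log_total_ge0.
have [cr [phi [delta [delta0 change]]]] := basis_change I_variety basis sn span.
have c_real : (c%:R : R) != 0 by rewrite pnatr_eq0 -lt0n.
(* Outside S all the terms vanish, so that the sums over the places are finite. *)
pose S := [set v | A v != 1] `|` [set v | D v != 1] `|`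
  ([set v | av v kappa != 1] `|` [set v | av v delta != 1]).
have Sfin : finite_set S.
  rewrite !finite_setU; split; split; [exact: A_const.2|exact: Dc.2| |];
  exact: pff_finite Kpff _ _.
pose rs : seq M := finmap.enum_fset (fset_set S).
have rs_uniq : uniq rs by exact: finmap.fset_uniq.
have rsP v : S v -> v \in rs by move=> Sv; rewrite [_ \in _]in_fset_set // inE.
have ArsP v : A v != 1 -> v \in rs by move=> h; apply: rsP; left; left.
have DrsP v : D v != 1 -> v \in rs by move=> h; apply: rsP; left; right.
have krsP v : av v kappa != 1 -> v \in rs by move=> h; apply: rsP; right; left.
have drsP v : av v delta != 1 -> v \in rs by move=> h; apply: rsP; right; right.
pose u v := - (d.-1%:R)^-1 * ln (av v kappa) + (l%:R * ln (A v) + ln (D v)) / n%:R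
  - (n * c)%:R^-1 * ln (av v delta).
have -> : (l%:R * log_total A + log_total D) / n%:R = \sum_(v <- rs) u v.
  rewrite sumrB big_split /= -mulr_suml big_split /= -!mulr_sumr.
  rewrite !(product_formula_log Kpff) // !mulr0 add0r subr0.
  by rewrite !(log_totalE rs_uniq).
apply: place_sum_le => // v.
  move=> vrs; have one (g : M -> R) : (g v != 1 -> v \in rs) -> g v = 1.
    by move=> h; apply/eqP; apply: contraNT vrs.
  rewrite /u (one A (ArsP v)) (one D (DrsP v)) (one (fun v => av v kappa) (krsP v)).
  by rewrite (one (fun v => av v delta) (drsP v)) ln1 !mulr0 addr0 mul0r !addr0 subr0.
apply: lne_sectional_d_le => // P EP /= Det0.
have b_absval := cf_abs_absval Cv v.
set eta_det := \det _ in Det0 *.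
have rho_gt0 : 0 < julia_radius d kappa v by exact: expR_gt0.
have D_gt0 : 0 < D v by apply: lt_le_trans (Dc.1 v).
have A_gt0 : 0 < A v by apply: lt_le_trans (A_const.1 v).
have delta_gt0 : 0 < av v delta by rewrite (absval_gt0 (pff_absval Kpff v)).
have det_gt0 : 0 < cf_abs eta_det by rewrite absval_gt0.
have bnd : cf_abs eta_det * av v delta <=
    A v ^+ (l * c) * (julia_radius d kappa v ^+ n * D v) ^+ c.
  rewrite -(cf_abs_embed Cv) -(absvalM b_absval) change => [|k]; last by case: (EP k).
  apply: (absval_det_le b_absval (A_const.1 v) (@A_weak v)).
  - exact: leq_trans rl.
  - by rewrite mulr_ge0 ?exprn_ge0 // ltW.
  - by move=> i j; rewrite mxE; apply: bound; case: (EP i).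
have lnbnd : ln (cf_abs eta_det) + ln (av v delta) <=
    (l * c)%:R * ln (A v) + c%:R * (n%:R * ln (julia_radius d kappa v) + ln (D v)).
  move: bnd; rewrite -ler_ln ?posrE ?mulr_gt0 ?exprn_gt0 ?mulr_gt0 ?exprn_gt0 //.
  rewrite !lnM ?posrE ?exprn_gt0 ?mulr_gt0 ?exprn_gt0 //.
  rewrite !lnXn ?mulr_gt0 ?exprn_gt0 // lnM ?posrE ?exprn_gt0 // lnXn //.
  by rewrite mulr_natl (mulr_natl _ c) (mulr_natl _ n).
rewrite -lerBrDr in lnbnd; apply: le_trans lnbnd _.
rewrite le_eqVlt; apply/orP; left; apply/eqP.
rewrite /u /julia_radius expRK !natrM; field.
by rewrite c_real d1 gt_eqF.
Qed.
End PlaceBounds.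

(** Bounds the number of factors in the generators of degree n. *)
Lemma log2_le_ln (R : realType) n k : (2 <= n)%N -> (2 ^ k <= n)%N ->
  k.+1%:R <= 2 / ln 2 * ln (n%:R : R).
Proof.
move=> n2 kn; have l2 : 0 < ln (2 : R) by apply: ln_gt0; rewrite ltr1n.
have n0 : (0 : R) < n%:R by rewrite ltr0n ltnW.
have hk : k%:R * ln (2 : R) <= ln n%:R.
  by rewrite mulr_natl -lnXn // ler_ln ?posrE ?exprn_gt0 // -natrX ler_nat.
have h2 : ln (2 : R) <= ln n%:R by rewrite ler_ln ?posrE // ler_nat.
rewrite mulrAC ler_pdivlMr // -natr1; nra.
Qed.

Theorem theorem1p1 (R : realType) (K : fieldType) (M : choiceType)
    (av : M -> K -> R) (Kpff : product_formula_field av)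
    (Cv : forall v : M, complex_field (av v))
    (N : nat) (I : {pred poly_ring K N})
    (X_variety : projective_variety I) (X_dim : dim_ge I 1)
    (d : nat) (d_ge2 : (2 <= d)%N)
    (f : 'I_N.+1 -> poly_ring K N) (f_morphism : is_morphism d f)
    (f_X : maps_into_itself f I) :
  exists C : R,
    forall F : 'I_N.+1 -> poly_ring K N, is_lift d f F ->
    forall (n c : nat) (eta : 'I_c -> cochain K N),
      (2 <= n)%N -> is_basis I n eta ->
      (place_sum (fun v =>
         lne (sectional_d n eta
                (filled_julia (Cv v) F `&` cone (cf_embed (Cv v)) I)))
       <= (C * ln n%:R / n%:R)%:E)%E.
Proof.
have [A [Ac A_weak]] := place_const_weak Kpff Cv.
have [B [Bc growth]] := place_growth Kpff Ac A_weak f_morphism (ltnW d_ge2).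
have [t generation] := pullback_generation d_ge2 f_morphism.
have [j0 large] := large_degree_sections X_variety.
have orbit F kappa v (P : 'I_N.+1 -> Cv v) : kappa != 0 -> (forall j, F j = kappa *: f j) ->
    filled_julia (Cv v) F P -> forall k,
    sup_norm (@cf_abs _ _ _ (Cv v)) (iter k (eval_map (cf_embed (Cv v)) F) P)
      <= julia_radius av d kappa v * B v.
  move=> k0 FE PF k; apply: (@filled_julia_orbit_le _ _ _ d f F d_ge2 kappa FE _ _
    (cf_embed (Cv v)) (cf_abs_absval Cv v)) => //.
  - exact: expR_gt0.
  - by rewrite cf_abs_embed julia_radiusE.
  - by case: Bc.
have ln2 : 0 < ln (2 : R) by apply: ln_gt0; rewrite ltr1n.
(* For n >= j0 the sections are forms, spanned by at most tau^k products of k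
   factors, where k is the number of binary digits of n. *)
pose tau := size (low_monomials N t).
pose C1 := (tau%:R * log_total A + t%:R * log_total B) * (2 / ln 2).
have C1_ge0 : 0 <= C1.
  apply: mulr_ge0; last by rewrite divr_ge0 // ltW.
  by rewrite addr_ge0 ?mulr_ge0 ?log_total_ge0.
have largeP F n c (eta : 'I_c -> cochain K N) : is_lift d f F -> (2 <= n)%N ->
    (j0 <= n)%N -> is_basis I n eta ->
    (place_sum (fun v => lne (sectional_d n eta
      (filled_julia (Cv v) F `&` cone (cf_embed (Cv v)) I))) <= (C1 * ln n%:R / n%:R)%:E)%E.
  move=> Flift n2 nj basis; have [kappa k0 FE] := lift_scalar f_morphism Flift.
  have n0 : (0 < n)%N by apply: leq_trans n2.
  have /andP[kn nk] := trunc_log_bounds (ltnSn 1) n0.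
  set k := (trunc_log 2 n).+1 in nk.
  apply: le_trans (place_sum_estimate Kpff Ac A_weak (l := tau * k) (D := fun v => B v ^+ (t * k))
    (F := F) X_variety d_ge2 n0 k0 basis
    (s := fun i : 'I_(size (gens d f t k n)) => poly_section (gens d f t k n)`_i) _ _ _ _ _) _.
  - move=> i; apply: is_section_poly => //; apply: (homogeneous_gens f_morphism (t := t) (k := k)).
    exact: mem_nth.
  - apply: spans_sections_poly; first by move=> s; exact: large.
    by move=> p; exact: gens_span.
  - apply: leq_trans (size_gens d f t k n) _.
    rewrite mulnC [(k * _)%N]mulnC expnM -/tau leq_exp2r //; exact/ltnW/ltn_expl.
  - exact: place_constX.
  - move=> v P i PF [Pnz _]; rewrite section_eval_poly //.
    apply: (@gens_bound _ _ _ d f F d_ge2 f_morphism kappa k0 FE _ _ (cf_embed (Cv v))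
      (cf_abs_absval Cv v)).
    + exact: expR_gt0.
    + by rewrite cf_abs_embed julia_radiusE.
    + by case: Bc.
    + exact: mem_nth.
    + exact: orbit.
  rewrite lee_fin ler_wpM2r ?invr_ge0 // log_totalX // !natrM.
  rewrite (_ : _ + _ = (tau%:R * log_total A + t%:R * log_total B) * k%:R); last by ring.
  rewrite /C1 -mulrA ler_wpM2l //; last exact: log2_le_ln.
  by rewrite ?addr_ge0 ?mulr_ge0 ?log_total_ge0.
(* For fixed n the constant may depend on a basis eta0 chosen once for all: it
   spans the sections, and the other bases are compared with it. *)
have smallP n : exists C, 0 <= C /\ forall F c (eta : 'I_c -> cochain K N),
    is_lift d f F -> (2 <= n)%N -> is_basis I n eta ->
    (place_sum (fun v => lne (sectional_d n eta
      (filled_julia (Cv v) F `&` cone (cf_embed (Cv v)) I))) <= (C * ln n%:R / n%:R)%:E)%E.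
  have [[c0 [eta0 basis0]]|none] := pselect (exists c0 (eta0 : 'I_c0 -> cochain K N),
      is_basis I n eta0); last first.
    by exists 0; split=> // F c eta _ _ basis; case: none; exists c, eta.
  have sec0 j : is_section I n (eta0 j) by case: basis0.
  have /choice[H HP] j := place_section_bound Kpff Ac A_weak X_variety (sec0 j).
  have Hc j : place_const (H j) by case: (HP j).
  pose D v := (\prod_j H j v) * B v ^+ n.
  have Dc : place_const D by apply: place_constM; [exact: place_const_prod|exact: place_constX].
  have T0 : 0 <= c0%:R * log_total A + log_total D.
    by rewrite addr_ge0 ?mulr_ge0 ?log_total_ge0.
  exists ((c0%:R * log_total A + log_total D) / ln 2); split.
    by rewrite divr_ge0 // ltW.
  move=> F c eta Flift n2 basis; have [kappa k0 FE] := lift_scalar f_morphism Flift.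
  have n0 : (0 < n)%N by apply: leq_trans n2.
  apply: le_trans (place_sum_estimate Kpff Ac A_weak (l := c0) (D := D) (F := F)
    X_variety d_ge2 n0 k0 basis sec0 _ _ Dc _) _.
  - exact: basis_spans.
  - exact/ltnW/ltn_expl.
  - move=> v P j PF Pcone; apply: le_trans ((HP j).2 v P Pcone) _.
    rewrite /D mulrCA ler_pM ?exprn_ge0 ?sup_norm_ge0 //.
    + by apply: le_trans ler01 _; case: (Hc j).
    + exact: le_prod_place_const.
    rewrite -exprMn lerXn2r ?nnegrE ?sup_norm_ge0 ?mulr_ge0 ?expR_ge0 //.
      by apply: le_trans ler01 _; case: Bc.
    exact: (orbit _ _ _ _ k0 FE PF 0%N).
  rewrite lee_fin ler_wpM2r ?invr_ge0 // -mulrA ler_peMr // mulrC ler_pdivlMr // mul1r.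
  by rewrite ler_ln ?posrE ?ltr0n // ler_nat.
have /choice[C2 C2P] := smallP.
exists (C1 + \sum_(i < j0) C2 i) => F Flift n c eta n2 basis.
have lnn : 0 <= ln (n%:R : R) / n%:R by rewrite divr_ge0 // ln_ge0 // ler1n ltnW.
have S0 : 0 <= \sum_(i < j0) C2 i by apply: sumr_ge0 => i _; case: (C2P i).
have [jn|nj] := leqP j0 n.
  apply: le_trans (largeP _ _ _ _ Flift n2 jn basis) _.
  by rewrite lee_fin -(mulrA C1) -(mulrA (C1 + _)) ler_wpM2r // lerDl.
apply: le_trans ((C2P n).2 _ _ _ Flift n2 basis) _.
rewrite lee_fin -(mulrA (C2 n)) -(mulrA (C1 + _)) ler_wpM2r // (bigD1 (Ordinal nj)) //= addrCA lerDl.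
by rewrite addr_ge0 // sumr_ge0 // => i _; case: (C2P i).
Qed.
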